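(* Let $f\in\mathcal{B}$ with $f(0)=0$ and let $\varphi=\{\varphi_n(r)\}_{n=0}^{\infty}\in\mathcal{F}$. Let $R_0\in(0,1)$ be the minimal positive root of the equation $\varphi_0(x)=2\sum_{n=1}^{\infty}(n+1)\varphi_n(x)$, and suppose that $$\varphi_0(r)\ge2\sum_{n=1}^{\infty}(n+1)\varphi_n(r)\quad\text{for all } r\in[0,R_0).$$ Then $$B_{f'}(\varphi,r)\le\varphi_0(r)\quad\text{for all } 0\le r\le R_0.$$ Moreover, the inequality is sharp in the following sense: if $\varphi_0(x)<2\sum_{n=1}^{\infty}(n+1)\varphi_n(x)$ for all $x$ in some interval $(R_0,R_0+\epsilon)$ with $\epsilon>0$, then the number $R_0$ cannot be improved, i.e. for no $R'\in(R_0,1)$ does the inequality $B_{f'}(\varphi,r)\le\varphi_0(r)$ hold for all $f\in\mathcal{B}$ with $f(0)=0$ and all $0\le r\le R'$.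
   Context: $\mathbb{D}=\{z\in\mathbb{C}:|z|<1\}$. $\mathcal{B}$ is the set of analytic functions $f$ on $\mathbb{D}$ with $\sup_{z\in\mathbb{D}}|f(z)|\le1$. $\mathcal{F}$ is the set of all sequences $\{\varphi_n(r)\}_{n=0}^{\infty}$ of nonnegative continuous functions on $[0,1)$ such that $\sum_{n=0}^{\infty}\varphi_n(r)$ converges locally uniformly with respect to $r\in[0,1)$. For an analytic function $F(z)=\sum_{n=0}^{\infty}c_nz^n$ on $\mathbb{D}$, $B_F(\varphi,r)=\sum_{n=0}^{\infty}|c_n|\varphi_n(r)$, with values in $[0,\infty]$; series of nonnegative terms are understood to take values in $[0,\infty]$. *)

(* Defs.v *)
From Stdlib Require Import Reals ClassicalEpsilon.
From Coquelicot Require Import Coquelicot.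
Open Scope R_scope.

Definition unit_disk (z : C) : Prop := Cmod z < 1.

(* Functions on the disk are total functions on C whose values outside the disk
   are irrelevant. *)
Definition analytic_on_disk (f : C -> C) : Prop :=
  forall z0 : C, unit_disk z0 ->
  exists (a : nat -> C) (rho : R), 0 < rho /\
    forall z : C, Cmod (z - z0)%C < rho -> is_pseries a (z - z0)%C (f z).

Definition unit_ball_analytic (f : C -> C) : Prop :=
  analytic_on_disk f /\ forall z : C, unit_disk z -> Cmod (f z) <= 1.

(* Junk when F has no power series expansion on the disk; for F analytic on the
   disk the expansion exists and is unique. *)
Definition taylor_coeffs (F : C -> C) : nat -> C :=
  epsilon (inhabits (fun _ : nat => RtoC 0))
    (fun c : nat -> C => forall z : C, unit_disk z -> is_pseries c z (F z)).

(* Sum over n >= m.  Only used for nonnegative terms, where the partial sums are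
   nondecreasing, so Lim_seq is their supremum in [0, +oo]. *)
Definition nonneg_sum_from (m : nat) (u : nat -> R) : Rbar :=
  Lim_seq (fun N : nat => sum_n_m u m N).

Definition unit_Ico (r : R) : Prop := 0 <= r < 1.

Definition admissible (phi : nat -> R -> R) : Prop :=
  (forall n r, unit_Ico r -> 0 <= phi n r) /\
  (forall n, continuous_on unit_Ico (phi n)) /\
  (forall x, unit_Ico x -> exists delta : posreal,
     CVU_dom (fun N r => sum_n (fun n => phi n r) N)
       (fun r => unit_Ico r /\ Rabs (r - x) < delta)).

Definition bohr_sum (F : C -> C) (phi : nat -> R -> R) (r : R) : Rbar :=
  nonneg_sum_from 0 (fun n => Cmod (taylor_coeffs F n) * phi n r).

(* The right-hand side of the equation defining R_0, with value in [0, +oo]. *)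
Definition twice_weighted_tail (phi : nat -> R -> R) (x : R) : Rbar :=
  Rbar_mult (Finite 2)
    (nonneg_sum_from 1 (fun n => INR (n + 1) * phi n x)).

(* Main.v *)
Require Import Defs.
From Stdlib Require Import Reals ClassicalEpsilon Lra Lia.
From Coquelicot Require Import Coquelicot.
Open Scope R_scope.

(** Write [f z = a1 z + a2 z^2 + ...]. The coefficients of [f'] are [(n+1) a(n+1)], and
    for [f] bounded by [1] with [f 0 = 0] one has [|a(n+1)| <= 1 - |a1|^2] for [n >= 1].
    Hence the Bohr sum of [f'] is at most [|a1| phi_0 + (1 - |a1|^2) T], where [T] is
    the sum of [(n+1) phi_n] over [n >= 1]. Wherever [2 T <= phi_0], this is at most
    [(1 - (1 - |a1|)^2 / 2) phi_0 <= phi_0] ([bohr_sum_le]). For the converse,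
    [f z = z (s - z) / (1 - s z)] has [a1 = s] and [|a(n+1)| = (1 - s^2) s^(n-1)], so that
    for [s] near [1] the Bohr sum of [f'] minus [phi_0] is about [(1 - s) (2 T - phi_0)],
    with a large finite part of [T] in place of [T] if that is infinite; so it is
    positive wherever [2 T > phi_0] ([bohr_sum_extremal_gt]).

    Analyticity means here that [f] has a power series around each point of the disk,
    so the expansion around [0], valid on the whole disk, has to be derived. The route
    is the Cauchy formula: local power series can be differentiated term by term
    ([power_series_derive]), so [f] has a continuous complex derivative; the mean of
    [f] against the Cauchy kernel over a circle does not change when the circle is
    shrunk to a point of the disk that it bounds ([cauchy_integral]); and expanding
    the kernel in a geometric series gives the expansion of [f] together with its
    coefficients as means over circles ([unit_ball_expansion]). The same description
    of the coefficients gives their bound, by taking the mean of [f] against a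
    multiple of the square of a binomial in [exp (i t)]
    ([unit_ball_coefficient_bound]). *)

(** * Elementary facts on real and complex numbers *)

(** Series identities carry the carrier type of the module structure on [C],
    which [ring] and [field] do not see through. *)
Ltac ceq := match goal with |- @eq _ ?a ?b => change (@eq C a b) end.

Lemma Bernoulli_lower (n : nat) (d : R) : 0 <= d <= 1 -> 1 - INR n * d <= (1 - d) ^ n.
Proof.
intros Hd. induction n as [|n IH]; [simpl; lra|].
rewrite S_INR, <- tech_pow_Rmult. pose proof (pos_INR n).
apply Rle_trans with ((1 - d) * (1 - INR n * d)).
- assert (0 <= INR n * d * d) by (repeat apply Rmult_le_pos; lra). lra.
- apply Rmult_le_compat_l; lra.
Qed.

Lemma pow_near_one (N : nat) (c : R) : c < 1 -> exists r, 0 < r < 1 /\ c < r ^ N.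
Proof.
intros Hc.
set (d := Rmin (1 / 2) ((1 - c) / (INR N + 1))).
pose proof (pos_INR N) as HN.
assert (Hd0 : 0 < d) by (apply Rmin_pos; [lra|apply Rdiv_lt_0_compat; lra]).
assert (Hd1 : d <= 1 / 2) by apply Rmin_l.
assert (Hd2 : d * (INR N + 1) <= 1 - c).
{ replace (1 - c) with ((1 - c) / (INR N + 1) * (INR N + 1)) by (field; lra).
  apply Rmult_le_compat_r; [lra|apply Rmin_r]. }
exists (1 - d). split; [lra|].
pose proof (Bernoulli_lower N d ltac:(lra)) as Bern. lra.
Qed.

Lemma Cmult_eq_0_reg_l (a b : C) : a <> 0 -> (a * b)%C = 0 -> b = 0.
Proof.
intros Ha H. replace b with (/ a * (a * b))%C by (field; exact Ha). rewrite H. ring.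
Qed.

Lemma Cmod_le_sum (z : C) : Cmod z <= Rabs (fst z) + Rabs (snd z).
Proof.
destruct z as [a b]. unfold Cmod. simpl fst; simpl snd.
rewrite <- (sqrt_Rsqr (Rabs a + Rabs b)).
- apply sqrt_le_1_alt. unfold Rsqr.
  pose proof (Rabs_pos a). pose proof (Rabs_pos b).
  replace (a ^ 2 + b ^ 2) with (Rabs a * Rabs a + Rabs b * Rabs b); [nra|].
  pose proof (Rsqr_abs a). pose proof (Rsqr_abs b). unfold Rsqr in *. simpl. lra.
- pose proof (Rabs_pos a). pose proof (Rabs_pos b). lra.
Qed.

Lemma Cconj_mult_self (z : C) : (Cconj z * z)%C = RtoC (Cmod z ^ 2).
Proof. rewrite Cmult_comm, <- Cmod2_conj, RtoC_pow. reflexivity. Qed.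

(** Multiplying by the inverse phase turns moduli into numbers, which lets linear
    functionals such as means be estimated through their real parts. *)
Lemma unit_rotation (z : C) : exists v, Cmod v = 1 /\ (v * z)%C = RtoC (Cmod z).
Proof.
destruct (Req_dec (Cmod z) 0) as [E|E].
- exists 1. rewrite Cmod_1, E. split; [reflexivity|]. apply Cmod_eq_0 in E. rewrite E. ring.
- assert (E' : RtoC (Cmod z) <> 0) by (intros H; apply RtoC_inj in H; contradiction).
  exists (Cconj z / RtoC (Cmod z))%C. split.
  + rewrite Cmod_div by exact E'. rewrite Cmod_conj, Cmod_R, Rabs_pos_eq by apply Cmod_ge_0.
  field; exact E.
  + replace (Cconj z / RtoC (Cmod z) * z)%C with ((Cconj z * z) / RtoC (Cmod z))%C
    by (field; exact E').
    rewrite Cconj_mult_self. simpl. rewrite Rmult_1_r, RtoC_mult. field; exact E'.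
Qed.

(** * Complex derivatives *)

(** Complex differentiability with explicit moduli. It implies [is_derive] over
    [C] and composes with real curves, whose derivatives live over another base
    field. *)
Definition C_diff (F : C -> C) (z l : C) : Prop :=
  forall eps : R, 0 < eps -> exists delta : R, 0 < delta /\
    forall w : C, Cmod (w - z)%C < delta ->
      Cmod (F w - F z - (w - z) * l)%C <= eps * Cmod (w - z)%C.

Lemma C_diff_is_derive F z l : C_diff F z l -> is_derive F z l.
Proof.
intros H. split.
- apply (is_linear_scal_l (K:=C_AbsRing) (V:=C_NormedModule) l).
- intros x Hx.
  assert (E : z = x).
  { apply (is_filter_lim_locally_unique (K:=C_AbsRing) (V:=AbsRing_NormedModule C_AbsRing) z x);
    exact Hx. }
  subst x. clear Hx. intros eps.
  destruct (H eps (cond_pos eps)) as [d [Hd Hw]].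
  exists (mkposreal d Hd). intros y Hy.
  exact (Hw y Hy).
Qed.

Lemma C_diff_C_derive F z l : C_diff F z l -> C_derive F z = l.
Proof. intros H. apply is_C_derive_unique, C_diff_is_derive, H. Qed.

Lemma C_diff_continuous F z l : C_diff F z l ->
  forall eps, 0 < eps -> exists d, 0 < d /\ forall w, Cmod (w - z)%C < d ->
    Cmod (F w - F z)%C < eps.
Proof.
intros H eps He. destruct (H 1 Rlt_0_1) as [d [Hd Hw]].
set (L := Cmod l). assert (HL : 0 <= L) by apply Cmod_ge_0.
exists (Rmin d (eps / (L + 2))). split.
- apply Rmin_pos; [lra|]. apply Rdiv_lt_0_compat; lra.
- intros w Hw'.
  assert (W1 : Cmod (w - z)%C < d) by (eapply Rlt_le_trans; [exact Hw'|apply Rmin_l]).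
  assert (W2 : Cmod (w - z)%C < eps / (L + 2)) by (eapply Rlt_le_trans; [exact Hw'|apply Rmin_r]).
  specialize (Hw w W1).
  replace (F w - F z)%C with ((F w - F z - (w - z) * l) + (w - z) * l)%C by ring.
  eapply Rle_lt_trans; [apply Cmod_triangle|]. rewrite Cmod_mult. fold L.
  pose proof (Cmod_ge_0 (w - z)%C).
  apply (Rmult_lt_compat_r (L + 2)) in W2; [|lra].
  replace (eps / (L + 2) * (L + 2)) with eps in W2 by (field; lra). nra.
Qed.

(** * Complex power series *)

Lemma is_series_C_spec (u : nat -> C) (l : C) :
  is_series (K:=C_AbsRing) (V:=C_NormedModule) u l <->
  forall eps, 0 < eps -> exists N, forall n, (N <= n)%nat ->
    Cmod (sum_n (G:=C_AbelianGroup) u n - l)%C < eps.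
Proof.
split.
- intros H eps He.
  destruct (proj1 (filterlim_locally_ball_norm (K:=C_AbsRing) (U:=C_NormedModule) _ l) H (mkposreal eps He)) as [N HN].
  exists N. intros n Hn. exact (HN n Hn).
- intros H. apply (filterlim_locally_ball_norm (K:=C_AbsRing) (U:=C_NormedModule)).
  intros eps. destruct (H eps (cond_pos eps)) as [N HN]. exists N. intros n Hn. exact (HN n Hn).
Qed.

Lemma pow_n_Cpow (z : C) n : pow_n (K:=C_AbsRing) z n = (z ^ n)%C.
Proof. induction n as [|n IH]; [reflexivity|]. simpl. rewrite IH. reflexivity. Qed.

Lemma is_pseries_C (a : nat -> C) (z l : C) :
  is_pseries a z l <-> is_series (K:=C_AbsRing) (V:=C_NormedModule) (fun n => a n * z ^ n)%C l.
Proof.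
assert (E : forall n, scal (V:=C_NormedModule) (pow_n (K:=C_AbsRing) z n) (a n) = (a n * z ^ n)%C).
{ intros n. exact (eq_trans (f_equal (fun w => Cmult w (a n)) (pow_n_Cpow z n)) (Cmult_comm _ _)). }
split; apply is_series_ext; intros n; [|symmetry]; apply E.
Qed.

Lemma is_series_C_bound (u : nat -> C) (l : C) (B : R) :
  is_series (K:=C_AbsRing) (V:=C_NormedModule) u l ->
  (forall n, Cmod (sum_n (G:=C_AbelianGroup) u n) <= B) -> Cmod l <= B.
Proof.
intros H HB. apply le_epsilon. intros e He.
destruct (proj1 (is_series_C_spec u l) H e He) as [N HN].
specialize (HN N (le_n N)). specialize (HB N).
replace l with (sum_n (G:=C_AbelianGroup) u N + (- (sum_n (G:=C_AbelianGroup) u N - l)))%C by ring.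
eapply Rle_trans; [apply Cmod_triangle|]. rewrite Cmod_opp. lra.
Qed.

(** Consecutive partial sums are eventually within [1] of the limit, so late terms
    are smaller than [2]; the finitely many others are bounded one at a time. *)
Lemma is_series_C_terms_bounded (u : nat -> C) (l : C) :
  is_series (K:=C_AbsRing) (V:=C_NormedModule) u l ->
  exists M, forall n, Cmod (u n) <= M.
Proof.
intros H.
destruct (proj1 (is_series_C_spec u l) H 1 Rlt_0_1) as [N HN].
assert (HB : forall m, exists M, 0 <= M /\ forall n, (n <= m)%nat -> Cmod (u n) <= M).
{ induction m as [|m [M [HM0 HM]]].
  - exists (Cmod (u O)). split; [apply Cmod_ge_0|]. intros n Hn. replace n with O by lia. lra.
  - exists (M + Cmod (u (S m))). pose proof (Cmod_ge_0 (u (S m))). split; [lra|].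
    intros n Hn. destruct (Nat.eq_dec n (S m)) as [->|]; [lra|].
    specialize (HM n ltac:(lia)). lra. }
destruct (HB (S N)) as [M [HM0 HM]].
exists (M + 2). intros n.
destruct (Nat.le_gt_cases n (S N)) as [Hn|Hn]; [specialize (HM n Hn); lra|].
destruct n as [|n]; [lia|].
pose proof (HN n ltac:(lia)) as H1. pose proof (HN (S n) ltac:(lia)) as H2.
rewrite sum_Sn in H2. change plus with Cplus in H2.
set (s := sum_n _ n) in *.
replace (u (S n)) with ((s + u (S n) - l) + (- (s - l)))%C by ring.
eapply Rle_trans; [apply Cmod_triangle|]. rewrite Cmod_opp. lra.
Qed.

Lemma nonneg_series_partial_le (v : nat -> R) n :
  (forall k, 0 <= v k) -> ex_series v -> sum_n v n <= Series v.
Proof.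
intros H0 Hv.
apply (is_lim_seq_incr_compare (sum_n v) (Series v)).
- apply Series_correct, Hv.
- intros k. rewrite sum_Sn. change plus with Rplus. specialize (H0 (S k)). lra.
Qed.

(** Writing [e n] for the remainder, [e (n+1) = (z+h) * e n + n * z^(n-1) * h^2],
    so [e n] is at most [n(n-1) q^(n-2) |h|^2] by induction: the coefficient is
    the one that differentiating the power [n] twice produces. *)
Lemma Cpow_taylor_bound (z h : C) (q : R) n :
  Cmod z <= q -> Cmod (z + h)%C <= q ->
  Cmod ((z + h) ^ (S (S n)) - z ^ (S (S n)) - h * (RtoC (INR (S (S n))) * z ^ (S n)))%C
   <= INR (S n) * INR (S (S n)) * q ^ n * Cmod h ^ 2.
Proof.
intros Hz Hzh. pose proof (Cmod_ge_0 z) as Hz0. pose proof (Cmod_ge_0 h) as Hh0.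
induction n as [|n IH].
- replace ((z + h) ^ 2 - z ^ 2 - h * (RtoC (INR 2) * z ^ 1))%C with (h * h)%C
   by (simpl; rewrite RtoC_plus; ring).
  rewrite Cmod_mult. simpl. nra.
- set (N := S (S n)) in *.
  replace ((z + h) ^ S N - z ^ S N - h * (RtoC (INR (S N)) * z ^ N))%C
    with ((z + h) * ((z + h) ^ N - z ^ N - h * (RtoC (INR N) * z ^ (S n)))
          + RtoC (INR N) * z ^ (S n) * (h * h))%C.
  2:{ rewrite (S_INR N), RtoC_plus. unfold N; simpl Cpow. ring. }
  eapply Rle_trans; [apply Cmod_triangle|].
  rewrite !Cmod_mult, Cmod_pow, Cmod_R, (Rabs_pos_eq _ (pos_INR N)).
  pose proof (Rmult_le_compat _ _ _ _ (Cmod_ge_0 _) (Cmod_ge_0 _) Hzh IH) as H1.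
  assert (H2 : Cmod z ^ S n <= q ^ S n) by (apply pow_incr; lra).
  assert (HN : INR N = INR (S n) + 1) by (unfold N; rewrite (S_INR (S n)); reflexivity).
  rewrite (S_INR N), HN in *.
  assert (0 <= INR (S n)) by apply pos_INR.
  assert (0 <= q ^ S n) by (apply pow_le; lra).
  eapply Rle_trans; [apply Rplus_le_compat; [exact H1|]|].
  + apply Rmult_le_compat_r; [nra|]. apply Rmult_le_compat_l; [lra|exact H2].
  + simpl (q ^ S n) in *. set (i := INR (S n)) in *. set (Q := q ^ n) in *.
    set (k := Cmod h) in *. assert (0 <= q * Q * k ^ 2)
      by (apply Rmult_le_pos; [assumption|apply pow2_ge_0]). nra.
Qed.

(** Between [|z - z0|] and [rho] there is room for a radius [q] at which the twice
    differentiated series of moduli converges, say to [B]. Summing the bounds on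
    the Taylor remainders of the powers, the sum of the series differs from its
    linear approximation by at most [B |w - z|^2]. *)
Lemma power_series_derive (a : nat -> C) (F : C -> C) (z0 : C) (rho : R) :
  (forall z, Cmod (z - z0)%C < rho -> is_pseries a (z - z0)%C (F z)) ->
  forall z, Cmod (z - z0)%C < rho ->
    is_pseries (fun n => RtoC (INR (S n)) * a (S n))%C (z - z0)%C (C_derive F z)
    /\ C_diff F z (C_derive F z).
Proof.
intros Ha z Hz.
set (x := (z - z0)%C) in *.
pose proof (Cmod_ge_0 x) as Hx0.
set (q := (Cmod x + rho) / 2). set (s := (q + rho) / 2).
assert (Hq : Cmod x < q) by (unfold q; lra).
assert (Hs : q < s < rho) by (unfold s, q; lra).
set (al := fun n => Cmod (a n)).
assert (Hrad : Rbar_lt (Rabs q) (CV_radius al)).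
{ rewrite Rabs_pos_eq by lra.
  destruct (CV_radius_bounded al) as [Hub _].
  apply Rbar_lt_le_trans with (Finite s); [simpl; lra|].
  apply Hub.
  assert (E : (z0 + RtoC s - z0)%C = RtoC s) by ring.
  assert (Hs' : Cmod (z0 + RtoC s - z0)%C < rho) by (rewrite E, Cmod_R, Rabs_pos_eq; lra).
  specialize (Ha _ Hs'). rewrite E in Ha.
  apply is_pseries_C, is_series_C_terms_bounded in Ha. destruct Ha as [M HM].
  exists M. intros n. specialize (HM n).
  rewrite Cmod_mult, Cmod_pow, Cmod_R, Rabs_pos_eq in HM by lra.
  unfold al. rewrite Rabs_pos_eq; [exact HM|].
  apply Rmult_le_pos; [apply Cmod_ge_0|apply pow_le; lra]. }
assert (Hd1 : ex_series (fun n => INR (S n) * al (S n) * q ^ n)).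
{ apply ex_pseries_derive in Hrad. destruct Hrad as [l Hl]. exists l.
  apply is_pseries_R in Hl. exact Hl. }
assert (Hd2 : ex_series (fun n => INR (S n) * (INR (S (S n)) * al (S (S n))) * q ^ n)).
{ rewrite <- CV_radius_derive in Hrad. apply ex_pseries_derive in Hrad. destruct Hrad as [l Hl].
exists l.
  apply is_pseries_R in Hl. exact Hl. }
set (a' := fun n => (RtoC (INR (S n)) * a (S n))%C).
assert (Hl : exists l, is_pseries a' x l).
{ assert (Hex : ex_series (K:=C_AbsRing) (V:=C_NormedModule) (fun n => a' n * x ^ n)%C).
  { apply (ex_series_le (K:=C_AbsRing) (V:=C_CompleteNormedModule) _ _) with (2 := Hd1).
    intros n. change norm with Cmod. unfold a'.
    rewrite !Cmod_mult, Cmod_pow, Cmod_R, Rabs_pos_eq by apply pos_INR.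
    apply Rmult_le_compat_l; [apply Rmult_le_pos; [apply pos_INR|apply Cmod_ge_0]|].
    apply pow_incr; lra. }
  destruct Hex as [l Hl]. exists l. apply is_pseries_C, Hl. }
destruct Hl as [l Hl].
set (v := fun n => INR (S n) * (INR (S (S n)) * al (S (S n))) * q ^ n) in *.
assert (Hv0 : forall n, 0 <= v n).
{ intros n. unfold v, al. repeat apply Rmult_le_pos; try apply pos_INR;
  [apply Cmod_ge_0|apply pow_le; lra]. }
set (B := Series v).
assert (HB0 : 0 <= B).
{ eapply Rle_trans; [|apply (nonneg_series_partial_le v 0 Hv0 Hd2)]. rewrite sum_O. apply Hv0. }
assert (Hquad : forall w, Cmod (w - z)%C < q - Cmod x ->
   Cmod (F w - F z - (w - z) * l)%C <= B * Cmod (w - z)%C ^ 2).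
{ intros w Hw. set (h := (w - z)%C) in *.
  assert (Hxh : Cmod (x + h)%C <= q) by (eapply Rle_trans; [apply Cmod_triangle|]; lra).
  assert (E : (w - z0)%C = (x + h)%C) by (unfold x, h; ring).
  assert (Hw' : Cmod (w - z0)%C < rho) by (rewrite E; lra).
  pose proof (Ha w Hw') as H1. pose proof (Ha z Hz) as H2. fold x in H2. rewrite E in H1.
  apply is_pseries_C in H1, H2, Hl.
  (* The derived series with its vanishing constant term put back, so that it
     can be subtracted termwise from the two others. *)
  assert (H3 : is_series (K:=C_AbsRing) (V:=C_NormedModule)
     (fun n => RtoC (INR n) * a n * x ^ (pred n))%C l).
  { apply is_series_decr_1. simpl (RtoC (INR 0) * _ * _)%C.
    assert (E0 : plus (G:=C_AbelianGroup) l (opp (RtoC (INR 0) * a 0%nat * x ^ (pred 0))%C) = l).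
    { change plus with Cplus. change opp with Copp. simpl. ring. }
    change (is_series (K:=C_AbsRing) (V:=C_NormedModule)
     (fun n => RtoC (INR (S n)) * a (S n) * x ^ n)%C
       (plus (G:=C_AbelianGroup) l (opp (RtoC (INR 0) * a 0%nat * x ^ (pred 0))%C))).
    rewrite E0. exact Hl. }
  pose proof (is_series_minus _ _ _ _ (is_series_minus _ _ _ _ H1 H2)
     (is_series_scal (K:=C_AbsRing) (V:=C_NormedModule) h _ _ H3)) as H4.
  set (T := fun n => (a n * ((x+h)^n - x^n - h * (RtoC (INR n) * x ^ (pred n))))%C).
  assert (H5 : is_series (K:=C_AbsRing) (V:=C_NormedModule) T (F w - F z - h * l)%C).
  { revert H4. apply is_series_ext. intros n. change plus with Cplus. change opp with Copp.
    change scal with Cmult. unfold T. ceq. ring. }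
  assert (T0 : T 0%nat = 0) by (unfold T; simpl; ring).
  assert (T1 : T 1%nat = 0) by (unfold T; simpl; ring).
  apply (is_series_C_bound T); [exact H5|].
  intros n.
  assert (HT : forall k, Cmod (T (S (S k))) <= v k * Cmod h ^ 2).
  { intros k. unfold T. rewrite Cmod_mult.
    pose proof (Cpow_taylor_bound x h q k (Rlt_le _ _ Hq) Hxh) as Hb.
    simpl pred. unfold v, al.
    eapply Rle_trans; [apply Rmult_le_compat_l; [apply Cmod_ge_0|exact Hb]|].
    right; ring. }
  assert (HTn : forall m, Cmod (sum_n (G:=C_AbelianGroup) T (S (S m))) <= sum_n v m * Cmod h ^ 2).
  { induction m as [|m IH].
    - rewrite !sum_Sn, !sum_O, T0, T1. change plus with Cplus.
      replace (0 + 0 + T 2%nat)%C with (T 2%nat) by ring. apply HT.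
    - rewrite sum_Sn, (sum_Sn v). change (@plus C_AbelianGroup) with Cplus.
    change (@plus R_AbelianGroup) with Rplus.
      eapply Rle_trans; [apply Cmod_triangle|]. rewrite Rmult_plus_distr_r.
      apply Rplus_le_compat; [exact IH|apply HT]. }
  assert (Hpos : 0 <= B * Cmod h ^ 2) by (apply Rmult_le_pos; [exact HB0|apply pow2_ge_0]).
  destruct n as [|[|m]].
  - rewrite sum_O, T0, Cmod_0. exact Hpos.
  - rewrite sum_Sn, sum_O, T0, T1. change plus with Cplus.
    replace (0 + 0)%C with (RtoC 0) by ring. rewrite Cmod_0. exact Hpos.
  - eapply Rle_trans; [apply HTn|]. apply Rmult_le_compat_r; [apply pow2_ge_0|].
    apply nonneg_series_partial_le; assumption. }
assert (Hcd : C_diff F z l).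
{ intros eps He.
  exists (Rmin (q - Cmod x) (eps / (B + 1))). split.
  - apply Rmin_pos; [lra|]. apply Rdiv_lt_0_compat; lra.
  - intros w Hw.
    assert (W1 : Cmod (w - z)%C < q - Cmod x) by (eapply Rlt_le_trans; [exact Hw|apply Rmin_l]).
    assert (W2 : Cmod (w - z)%C < eps / (B + 1)) by (eapply Rlt_le_trans; [exact Hw|apply Rmin_r]).
    eapply Rle_trans; [apply Hquad, W1|].
    pose proof (Cmod_ge_0 (w - z)%C). set (d := Cmod (w-z)%C) in *.
    assert (d * (B + 1) <= eps).
    { apply (Rmult_lt_compat_r (B+1)) in W2; [|lra].
      replace (eps / (B + 1) * (B + 1)) with eps in W2 by (field; lra). lra. }
    assert (B * d <= eps) by nra. simpl. nra. }
rewrite (C_diff_C_derive _ _ _ Hcd). split; assumption.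
Qed.

Lemma geometric_pseries (c w h : C) : Cmod (w * h)%C < 1 ->
  is_pseries (fun n => c * w ^ n)%C h (c / (1 - w * h))%C.
Proof.
intros Hq. apply is_pseries_C. set (q := (w * h)%C) in *.
assert (Hq1 : (1 - q)%C <> 0).
{ intros E. apply Ceq_minus in E. rewrite <- E, Cmod_1 in Hq. lra. }
set (K := Cmod (c / (1 - q))%C). assert (HK : 0 <= K) by apply Cmod_ge_0.
assert (S1 : forall n, sum_n (G:=C_AbelianGroup) (fun n => c * w ^ n * h ^ n)%C n = (c / (1 - q) - c / (1 - q) * q ^ S n)%C).
{ induction n as [|n IH].
  - rewrite sum_O. simpl. ceq. field. exact Hq1.
  - rewrite sum_Sn, IH. change plus with Cplus.
    rewrite <- Cmult_assoc, <- Cpow_mult_l. fold q. rewrite (Cpow_S q (S n)). ceq. field.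
    exact Hq1. }
apply is_series_C_spec. intros eps He.
destruct (pow_lt_1_zero (Cmod q)) with (y := eps / (K + 1)) as [N HN].
{ rewrite Rabs_pos_eq; [exact Hq|apply Cmod_ge_0]. }
{ apply Rdiv_lt_0_compat; lra. }
exists N. intros n Hn. rewrite S1.
replace (c / (1 - q) - c / (1 - q) * q ^ S n - c / (1 - q))%C
  with (- (c / (1 - q) * q ^ S n))%C by ring.
rewrite Cmod_opp, Cmod_mult, Cmod_pow. fold K.
specialize (HN (S n) ltac:(lia)). rewrite Rabs_pos_eq in HN by (apply pow_le, Cmod_ge_0).
assert (0 <= Cmod q ^ S n) by (apply pow_le, Cmod_ge_0).
apply (Rmult_lt_compat_l (K + 1)) in HN; [|lra].
replace ((K + 1) * (eps / (K + 1))) with eps in HN by (field; lra). nra.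
Qed.

(** Since [0 ^ 0 = 1], the sequence [c * 0 ^ n] is [c, 0, 0, ...]. *)
Lemma constant_pseries (c h : C) : is_pseries (fun n => c * 0 ^ n)%C h c.
Proof.
assert (H : Cmod (0 * h)%C < 1) by (rewrite Cmult_0_l, Cmod_0; lra).
pose proof (geometric_pseries c 0 h H) as G.
replace (c / (1 - 0 * h))%C with c in G; [exact G|]. field.
Qed.

(** The constant coefficient is the value at [0], and the derived series again
    sums to zero, so the statement follows by induction on the index. *)
Lemma power_series_zero (d : nat -> C) (rho : R) : 0 < rho ->
  (forall z, Cmod z < rho -> is_pseries d z (RtoC 0)) -> forall n, d n = RtoC 0.
Proof.
intros Hr H n. revert d H. induction n as [|n IH]; intros d H.
- assert (H0 : Cmod 0 < rho) by (rewrite Cmod_0; exact Hr).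
  specialize (H _ H0). pose proof (is_pseries_0 (K:=C_AbsRing) (V:=C_NormedModule) d) as H1.
  exact (filterlim_locally_unique (K:=C_AbsRing) (V:=C_NormedModule) _ _ _ H1 H).
- assert (H' : forall z, Cmod (z - 0)%C < rho ->
  is_pseries d (z - 0)%C (RtoC 0)) by (intros z Hz; apply H, Hz).
  assert (E : forall z : C, (z - 0)%C = z) by (intros z; ring).
  specialize (IH (fun n => RtoC (INR (S n)) * d (S n))%C).
  assert (IH' : (RtoC (INR (S n)) * d (S n))%C = 0).
  { apply IH. intros z Hz. rewrite <- (E z) in Hz.
    destruct (power_series_derive d (fun _ => RtoC 0) 0 rho H' z Hz) as [H1 _].
    rewrite E in H1. replace (C_derive (fun _ => RtoC 0) z) with (RtoC 0) in H1; [exact H1|].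
    symmetry. apply C_diff_C_derive. intros eps He. exists 1. split; [lra|]. intros w _.
    replace (0 - 0 - (w - z) * 0)%C with (RtoC 0) by ring. rewrite Cmod_0.
    apply Rmult_le_pos; [lra|apply Cmod_ge_0]. }
  apply Ceq_minus. replace (d (S n) - 0)%C
    with (/ RtoC (INR (S n)) * (RtoC (INR (S n)) * d (S n)))%C.
  + rewrite IH'. ring.
  + field. intros Hn. apply RtoC_inj in Hn. apply (not_0_INR (S n)); [lia|exact Hn].
Qed.

Lemma power_series_unique (a b : nat -> C) (F : C -> C) (rho : R) : 0 < rho ->
  (forall z, Cmod z < rho -> is_pseries a z (F z)) ->
  (forall z, Cmod z < rho -> is_pseries b z (F z)) -> forall n, a n = b n.
Proof.
intros Hr Ha Hb n.
apply Ceq_minus.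
apply (power_series_zero (fun n => a n - b n)%C rho Hr).
intros z Hz.
pose proof (is_pseries_minus _ _ _ _ _ (Ha z Hz) (Hb z Hz)) as H.
replace (RtoC 0) with (plus (G:=C_AbelianGroup) (F z) (opp (F z))) by apply (plus_opp_r (G:=C_AbelianGroup)).
exact H.
Qed.

Lemma taylor_coeffs_eq (F : C -> C) (c : nat -> C) :
  (forall z, unit_disk z -> is_pseries c z (F z)) -> forall n, taylor_coeffs F n = c n.
Proof.
intros H. apply (power_series_unique _ _ F 1); [lra| |exact H].
apply (epsilon_spec (inhabits (fun _ : nat => RtoC 0))
    (fun c : nat -> C => forall z : C, unit_disk z -> is_pseries c z (F z))).
exists c. exact H.
Qed.

Lemma taylor_coeffs_derive (F : C -> C) (a : nat -> C) :
  (forall z, unit_disk z -> is_pseries a z (F z)) ->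
  forall n, taylor_coeffs (C_derive F) n = (RtoC (INR (S n)) * a (S n))%C.
Proof.
intros H. apply taylor_coeffs_eq. intros z Hz.
assert (E : forall z : C, (z - 0)%C = z) by (intros w; ring).
destruct (power_series_derive a F 0 1) with (z := z) as [H1 _].
- intros w Hw. rewrite E in *. apply H, Hw.
- rewrite E. exact Hz.
- rewrite E in H1. exact H1.
Qed.

(** * Functions analytic on the disk *)

Lemma analytic_C_diff f : analytic_on_disk f ->
  forall z, unit_disk z -> C_diff f z (C_derive f z).
Proof.
intros H z Hz. destruct (H z Hz) as [a [rho [Hr Ha]]].
apply (power_series_derive a f z rho Ha z).
replace (z - z)%C with (RtoC 0) by ring. rewrite Cmod_0. exact Hr.
Qed.

(** Near each point the derivative is itself the sum of a power series, hence
    differentiable. *)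
Lemma analytic_derive_continuous f : analytic_on_disk f ->
  forall z, unit_disk z -> forall eps, 0 < eps -> exists d, 0 < d /\
    forall w, Cmod (w - z)%C < d -> Cmod (C_derive f w - C_derive f z)%C < eps.
Proof.
intros H z Hz. destruct (H z Hz) as [a [rho [Hr Ha]]].
assert (Hzz : Cmod (z - z)%C < rho)
  by (replace (z - z)%C with (RtoC 0) by ring; rewrite Cmod_0; exact Hr).
apply C_diff_continuous with (l := C_derive (C_derive f) z).
apply (power_series_derive (fun n => RtoC (INR (S n)) * a (S n))%C _ z rho); [|exact Hzz].
intros w Hw. apply (power_series_derive a f z rho Ha w Hw).
Qed.

Lemma analytic_mult_id f : analytic_on_disk f -> analytic_on_disk (fun z => z * f z)%C.
Proof.
intros H z0 Hz0. destruct (H z0 Hz0) as [a [rho [Hr Ha]]].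
exists (PS_plus (K:=C_AbsRing) (V:=C_NormedModule) (PS_scal (K:=C_AbsRing) (V:=C_NormedModule) z0 a)
   (PS_incr_1 (K:=C_AbsRing) (V:=C_NormedModule) a)), rho. split; [exact Hr|].
intros z Hz. specialize (Ha z Hz).
replace (z * f z)%C with (plus (G:=C_AbelianGroup) (scal (V:=C_NormedModule) z0 (f z)) (scal (V:=C_NormedModule) (z - z0)%C (f z))).
- apply (is_pseries_plus (K:=C_AbsRing) (V:=C_NormedModule)).
  + apply (is_pseries_scal (K:=C_AbsRing) (V:=C_NormedModule)); [apply Cmult_comm|exact Ha].
  + apply (is_pseries_incr_1 (K:=C_AbsRing) (V:=C_NormedModule)); exact Ha.
- change plus with Cplus. change scal with Cmult. ceq. ring.
Qed.

Lemma analytic_mult_pow f m : analytic_on_disk f -> analytic_on_disk (fun z => z ^ m * f z)%C.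
Proof.
intros H. induction m as [|m IH].
- intros z0 Hz0. destruct (H z0 Hz0) as [a [rho [Hr Ha]]].
  exists a, rho. split; [exact Hr|]. intros z Hz. simpl. rewrite Cmult_1_l. apply Ha, Hz.
- apply analytic_mult_id in IH. intros z0 Hz0. destruct (IH z0 Hz0) as [a [rho [Hr Ha]]].
  exists a, rho. split; [exact Hr|]. intros z Hz. specialize (Ha z Hz). simpl in *.
  rewrite <- Cmult_assoc. exact Ha.
Qed.

Lemma analytic_const c : analytic_on_disk (fun _ => c).
Proof.
intros z0 _. exists (fun n => c * 0 ^ n)%C, 1. split; [lra|]. intros z _. apply constant_pseries.
Qed.

(** * Continuity of complex-valued maps *)

(** Componentwise, for an arbitrary source, so that the same rules serve functions
    of one real parameter and of two. *)
Definition C_continuous {T : UniformSpace} (g : T -> C) (x : T) : Prop :=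
  continuous (fun y => fst (g y)) x /\ continuous (fun y => snd (g y)) x.

Lemma C_continuous_ext {T : UniformSpace} (f g : T -> C) x : (forall y, f y = g y) ->
  C_continuous f x -> C_continuous g x.
Proof. intros E [H1 H2]. split; [revert H1|revert H2]; apply continuous_ext; intros y; rewrite E;
  reflexivity. Qed.

Lemma C_continuous_const {T : UniformSpace} (c : C) (x : T) : C_continuous (fun _ => c) x.
Proof. split; apply continuous_const. Qed.

Lemma C_continuous_plus {T : UniformSpace} (f g : T -> C) x : C_continuous f x ->
  C_continuous g x -> C_continuous (fun y => f y + g y)%C x.
Proof.
intros [f1 f2] [g1 g2]. split; apply (continuous_plus (V:=R_NormedModule)); assumption.
Qed.

Lemma C_continuous_mult {T : UniformSpace} (f g : T -> C) x : C_continuous f x ->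
  C_continuous g x -> C_continuous (fun y => f y * g y)%C x.
Proof.
intros [f1 f2] [g1 g2]. split.
- apply (continuous_minus (V:=R_NormedModule)); apply (continuous_mult (K:=R_AbsRing)); assumption.
- apply (continuous_plus (V:=R_NormedModule)); apply (continuous_mult (K:=R_AbsRing)); assumption.
Qed.

Lemma C_continuous_minus {T : UniformSpace} (f g : T -> C) x : C_continuous f x ->
  C_continuous g x -> C_continuous (fun y => f y - g y)%C x.
Proof.
intros Hf Hg. apply (C_continuous_ext (fun y => f y + RtoC (-1) * g y)%C); [intros; ring|].
apply C_continuous_plus; [exact Hf|]. apply C_continuous_mult; [apply C_continuous_const|exact Hg].
Qed.

Lemma C_continuous_pow {T : UniformSpace} (f : T -> C) n x : C_continuous f x ->
  C_continuous (fun y => f y ^ n)%C x.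
Proof.
intros H. induction n as [|n IH]; simpl; [apply C_continuous_const|apply C_continuous_mult;
  assumption].
Qed.

Lemma C_continuous_spec {T : UniformSpace} (g : T -> C) x :
  C_continuous g x <-> forall eps, 0 < eps -> locally x (fun y => Cmod (g y - g x)%C < eps).
Proof.
split.
- intros [H1 H2] eps He.
  assert (He2 : 0 < eps / 2) by lra.
  generalize (filter_and _ _ (proj1 (filterlim_locally _ _) H1 (mkposreal _ He2))
     (proj1 (filterlim_locally _ _) H2 (mkposreal _ He2))).
  apply filter_imp. intros y [h1 h2].
  change (Rabs (fst (g y) - fst (g x)) < eps / 2) in h1.
  change (Rabs (snd (g y) - snd (g x)) < eps / 2) in h2.
  eapply Rle_lt_trans; [apply Cmod_le_sum|]. simpl. unfold Rminus in *. lra.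
- intros H. split; apply filterlim_locally; intros eps; generalize (H eps (cond_pos eps));
  apply filter_imp; intros y Hy; pose proof (Rmax_Cmod (g y - g x)%C) as HM.
  + change (Rabs (fst (g y) - fst (g x)) < eps).
    eapply Rle_lt_trans; [|exact Hy]. eapply Rle_trans; [|exact HM]. apply Rmax_l.
  + change (Rabs (snd (g y) - snd (g x)) < eps).
    eapply Rle_lt_trans; [|exact Hy]. eapply Rle_trans; [|exact HM]. apply Rmax_r.
Qed.

Lemma C_continuous_comp {T : UniformSpace} (F : C -> C) (g : T -> C) x :
  C_continuous g x ->
  (forall eps, 0 < eps -> exists d, 0 < d /\ forall w, Cmod (w - g x)%C < d ->
    Cmod (F w - F (g x))%C < eps) ->
  C_continuous (fun y => F (g y)) x.
Proof.
intros Hg HF. apply C_continuous_spec. intros eps He. destruct (HF eps He) as [d [Hd H]].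
generalize (proj1 (C_continuous_spec g x) Hg d Hd). apply filter_imp. intros y Hy. apply H, Hy.
Qed.

Lemma C_continuous_inv {T : UniformSpace} (g : T -> C) x : g x <> 0 -> C_continuous g x ->
  C_continuous (fun y => / g y)%C x.
Proof.
intros Hn [H1 H2].
assert (HD : continuous (fun y => / (fst (g y) ^ 2 + snd (g y) ^ 2)) x).
{ apply (continuous_comp (fun y => fst (g y) ^ 2 + snd (g y) ^ 2) Rinv).
  - simpl. apply (continuous_plus (V:=R_NormedModule)); apply (continuous_mult (K:=R_AbsRing));
    try assumption;
     apply (continuous_mult (K:=R_AbsRing)); try assumption; apply continuous_const.
  - apply continuous_Rinv. intros E. apply Hn.
    apply Cmod_eq_0. unfold Cmod. rewrite E. apply sqrt_0. }
split.
- apply (continuous_mult (K:=R_AbsRing)); assumption.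
- apply (continuous_mult (K:=R_AbsRing)); [|exact HD].
apply (continuous_opp (V:=R_NormedModule)). exact H2.
Qed.

(** * Curves in the plane and the unit circle *)

Lemma is_derive_R_spec (f : R -> R) (x l : R) :
  is_derive f x l <-> forall eps, 0 < eps ->
    locally x (fun y => Rabs (f y - f x - (y - x) * l) <= eps * Rabs (y - x)).
Proof.
split.
- intros [_ H] eps He. exact (H x (fun P HP => HP) (mkposreal eps He)).
- intros H. split; [apply (is_linear_scal_l (K:=R_AbsRing) (V:=R_NormedModule))|].
  intros y Hy. assert (E : x = y)
    by (apply (is_filter_lim_locally_unique (K:=R_AbsRing) (V:=R_NormedModule)); exact Hy).
  subst y. intros eps. exact (H eps (cond_pos eps)).
Qed.

Definition curve_diff (g : R -> C) (x : R) (v : C) : Prop :=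
  forall eps, 0 < eps -> locally x (fun y => Cmod (g y - g x - RtoC (y - x) * v)%C <= eps * Rabs (y - x)).

Lemma curve_diff_of_components (g : R -> C) x a b :
  is_derive (fun y => fst (g y)) x a -> is_derive (fun y => snd (g y)) x b -> curve_diff g x (a, b).
Proof.
intros H1 H2 eps He. assert (He2 : 0 < eps / 2) by lra.
generalize (filter_and _ _ (proj1 (is_derive_R_spec _ _ _) H1 _ He2) (proj1 (is_derive_R_spec _ _ _) H2 _ He2)).
apply filter_imp. intros y [h1 h2].
eapply Rle_trans; [apply Cmod_le_sum|]. simpl.
replace (fst (g y) + - fst (g x) + - ((y - x) * a - 0 * b))
  with (fst (g y) - fst (g x) - (y - x) * a) by ring.
replace (snd (g y) + - snd (g x) + - ((y - x) * b + 0 * a))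
  with (snd (g y) - snd (g x) - (y - x) * b) by ring.
lra.
Qed.

Lemma curve_diff_fst (g : R -> C) x v : curve_diff g x v ->
  is_derive (fun y => fst (g y)) x (fst v).
Proof.
intros H. apply is_derive_R_spec. intros eps He. generalize (H eps He). apply filter_imp.
intros y Hy.
eapply Rle_trans; [|exact Hy]. eapply Rle_trans; [|apply re_le_Cmod]. right. f_equal. simpl. ring.
Qed.

Lemma curve_diff_scal (d : C) (g : R -> C) x v : curve_diff g x v ->
  curve_diff (fun y => d * g y)%C x (d * v)%C.
Proof.
intros H eps He. set (D := Cmod d). assert (HD : 0 <= D) by apply Cmod_ge_0.
assert (He' : 0 < eps / (D + 1)) by (apply Rdiv_lt_0_compat; lra).
generalize (H _ He'). apply filter_imp. intros y Hy.
replace (d * g y - d * g x - RtoC (y - x) * (d * v))%C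
  with (d * (g y - g x - RtoC (y - x) * v))%C by ring.
rewrite Cmod_mult. fold D.
eapply Rle_trans; [apply Rmult_le_compat_l; [exact HD|exact Hy]|].
rewrite <- Rmult_assoc. apply Rmult_le_compat_r; [apply Rabs_pos|].
assert (E : eps / (D + 1) * (D + 1) = eps) by (field; lra). nra.
Qed.

Lemma curve_diff_comp (F : C -> C) (g : R -> C) x l v :
  C_diff F (g x) l -> curve_diff g x v -> curve_diff (fun y => F (g y)) x (l * v)%C.
Proof.
intros HF Hg eps He.
set (L := Cmod l). set (V := Cmod v). assert (HL : 0 <= L) by apply Cmod_ge_0.
assert (HV : 0 <= V) by apply Cmod_ge_0.
set (e1 := eps / (2 * (V + 1))). set (e2 := eps / (2 * (L + 1))).
assert (He1 : 0 < e1) by (apply Rdiv_lt_0_compat; lra).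
assert (He2 : 0 < e2) by (apply Rdiv_lt_0_compat; lra).
assert (E1 : e1 * (V + 1) = eps / 2) by (unfold e1; field; lra).
assert (E2 : e2 * (L + 1) = eps / 2) by (unfold e2; field; lra).
destruct (HF e1 He1) as [d [Hd HFd]].
assert (Hd' : 0 < d / (V + 1)) by (apply Rdiv_lt_0_compat; lra).
assert (Hnear : locally x (fun y => Rabs (y - x) < d / (V + 1))).
{ exists (mkposreal _ Hd'). intros y Hy. exact Hy. }
generalize (filter_and _ _ Hnear (filter_and _ _ (Hg e2 He2) (Hg 1 Rlt_0_1))). apply filter_imp.
intros y [hn [h2 h1]].
set (r := Rabs (y - x)) in *. assert (Hr : 0 <= r) by apply Rabs_pos.
assert (B1 : Cmod (g y - g x)%C <= (V + 1) * r).
{ replace (g y - g x)%C with ((g y - g x - RtoC (y - x) * v) + RtoC (y - x) * v)%C by ring.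
  eapply Rle_trans; [apply Cmod_triangle|]. rewrite Cmod_mult, Cmod_R. fold r V. lra. }
assert (B2 : Cmod (g y - g x)%C < d).
{ eapply Rle_lt_trans; [exact B1|]. apply (Rmult_lt_compat_l (V+1)) in hn; [|lra].
  replace ((V + 1) * (d / (V + 1))) with d in hn by (field; lra). exact hn. }
replace (F (g y) - F (g x) - RtoC (y - x) * (l * v))%C with
  ((F (g y) - F (g x) - (g y - g x) * l) + l * (g y - g x - RtoC (y - x) * v))%C by ring.
eapply Rle_trans; [apply Cmod_triangle|]. rewrite Cmod_mult. fold L.
specialize (HFd _ B2).
assert (e1 * Cmod (g y - g x)%C <= eps / 2 * r).
{ rewrite <- E1. rewrite Rmult_assoc. apply Rmult_le_compat_l; lra. }
assert (L * Cmod (g y - g x - RtoC (y - x) * v)%C <= eps / 2 * r).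
{ eapply Rle_trans; [apply Rmult_le_compat_l; [exact HL|exact h2]|].
  rewrite <- Rmult_assoc. apply Rmult_le_compat_r; [exact Hr|]. nra. }
lra.
Qed.

Definition unit_circle (t : R) : C := (cos t, sin t).

Lemma Cmod_unit_circle t : Cmod (unit_circle t) = 1.
Proof.
unfold Cmod, unit_circle; simpl. rewrite !Rmult_1_r.
pose proof (sin2_cos2 t) as H. unfold Rsqr in H. rewrite Rplus_comm, H. apply sqrt_1.
Qed.

Lemma unit_circle_neq0 t : unit_circle t <> 0.
Proof. intros H. pose proof (Cmod_unit_circle t) as E. rewrite H, Cmod_0 in E. lra. Qed.

Lemma unit_circle_diff t : curve_diff unit_circle t (Ci * unit_circle t)%C.
Proof.
replace (Ci * unit_circle t)%C with (- sin t, cos t)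
  by (unfold unit_circle, Ci, Cmult; simpl; f_equal; ring).
apply curve_diff_of_components; simpl; auto_derive; trivial; ring.
Qed.

Lemma curve_diff_continuous g x v : curve_diff g x v -> C_continuous g x.
Proof.
intros H. split.
- apply (ex_derive_continuous (K:=R_AbsRing) (V:=R_NormedModule)). exists (fst v).
apply curve_diff_fst, H.
- apply (continuous_ext (fun y => fst (- Ci * g y)%C)).
  + intros y. simpl. ring.
  + apply (ex_derive_continuous (K:=R_AbsRing) (V:=R_NormedModule)). eexists.
  apply curve_diff_fst, curve_diff_scal, H.
Qed.

Lemma unit_circle_continuous t : C_continuous unit_circle t.
Proof. eapply curve_diff_continuous, unit_circle_diff. Qed.

Lemma inv_unit_circle t : (/ unit_circle t)%C = Cconj (unit_circle t).
Proof.
assert (E : (Cconj (unit_circle t) * unit_circle t)%C = 1).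
{ rewrite Cconj_mult_self, Cmod_unit_circle. f_equal. ring. }
transitivity (Cconj (unit_circle t) * unit_circle t * / unit_circle t)%C.
- rewrite E. ring.
- field. apply unit_circle_neq0.
Qed.

(** * Means over a period *)

Definition period_mean (g : R -> C) : C :=
  (RInt (fun t => fst (g t)) 0 (2 * PI) / (2 * PI), RInt (fun t => snd (g t)) 0 (2 * PI) / (2 * PI)).

Lemma ex_RInt_fst (g : R -> C) a b : (forall t, C_continuous g t) ->
  ex_RInt (fun t => fst (g t)) a b.
Proof. intros H. apply (ex_RInt_continuous (V:=R_CompleteNormedModule)). intros t _. apply H. Qed.
Lemma ex_RInt_snd (g : R -> C) a b : (forall t, C_continuous g t) ->
  ex_RInt (fun t => snd (g t)) a b.
Proof. intros H. apply (ex_RInt_continuous (V:=R_CompleteNormedModule)). intros t _. apply H. Qed.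

Lemma period_mean_ext f g : (forall t, f t = g t) -> period_mean f = period_mean g.
Proof. intros E. unfold period_mean.
f_equal; f_equal; apply RInt_ext; intros t _; rewrite E; reflexivity. Qed.

Lemma period_mean_plus f g : (forall t, C_continuous f t) -> (forall t, C_continuous g t) ->
  period_mean (fun t => f t + g t)%C = (period_mean f + period_mean g)%C.
Proof.
intros Hf Hg. unfold period_mean, Cplus; simpl fst; simpl snd.
rewrite (RInt_plus (V:=R_CompleteNormedModule) (fun t => fst (f t)) (fun t => fst (g t)))
  by (apply ex_RInt_fst; assumption).
rewrite (RInt_plus (V:=R_CompleteNormedModule) (fun t => snd (f t)) (fun t => snd (g t)))
  by (apply ex_RInt_snd; assumption).
change plus with Rplus. f_equal; field; apply PI_neq0.
Qed.

Lemma period_mean_scal (c : C) g : (forall t, C_continuous g t) ->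
  period_mean (fun t => c * g t)%C = (c * period_mean g)%C.
Proof.
intros Hg. unfold period_mean, Cmult; simpl fst; simpl snd.
destruct c as [a b]; simpl fst; simpl snd.
pose proof (ex_RInt_fst g 0 (2*PI) Hg) as E1. pose proof (ex_RInt_snd g 0 (2*PI) Hg) as E2.
assert (F1 : RInt (fun t => a * fst (g t) - b * snd (g t)) 0 (2*PI) = a * RInt (fun t => fst (g t)) 0 (2*PI) - b * RInt (fun t => snd (g t)) 0 (2*PI)).
{ rewrite (RInt_minus (V:=R_CompleteNormedModule) (fun t => a * fst (g t)) (fun t => b * snd (g t)))
   by (apply (ex_RInt_scal (V:=R_NormedModule)); assumption).
  rewrite (RInt_scal (V:=R_CompleteNormedModule) (fun t => fst (g t))) by assumption.
  rewrite (RInt_scal (V:=R_CompleteNormedModule) (fun t => snd (g t))) by assumption. reflexivity. }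
assert (F2 : RInt (fun t => a * snd (g t) + b * fst (g t)) 0 (2*PI) = a * RInt (fun t => snd (g t)) 0 (2*PI) + b * RInt (fun t => fst (g t)) 0 (2*PI)).
{ rewrite (RInt_plus (V:=R_CompleteNormedModule) (fun t => a * snd (g t)) (fun t => b * fst (g t)))
   by (apply (ex_RInt_scal (V:=R_NormedModule)); assumption).
  rewrite (RInt_scal (V:=R_CompleteNormedModule) (fun t => fst (g t))) by assumption.
  rewrite (RInt_scal (V:=R_CompleteNormedModule) (fun t => snd (g t))) by assumption. reflexivity. }
rewrite F1, F2. f_equal; field; apply PI_neq0.
Qed.

Lemma period_mean_const c : period_mean (fun _ => c) = c.
Proof.
unfold period_mean. rewrite !RInt_const. destruct c as [a b]. unfold scal; simpl.
unfold mult; simpl.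
f_equal; field; apply PI_neq0.
Qed.

Lemma period_mean_fst_le f g : (forall t, C_continuous f t) -> (forall t, C_continuous g t) ->
  (forall t, fst (f t) <= fst (g t)) -> fst (period_mean f) <= fst (period_mean g).
Proof.
intros Hf Hg H. unfold period_mean; simpl. pose proof PI_RGT_0.
apply Rmult_le_compat_r; [left; apply Rinv_0_lt_compat; lra|].
apply RInt_le; [lra|apply ex_RInt_fst; assumption|apply ex_RInt_fst; assumption|].
intros t _. apply H.
Qed.

(** The upper bound is the real part of a complex function because the majorants
    that occur are trigonometric polynomials, whose means are known. *)
Lemma Cmod_period_mean_le g h : (forall t, C_continuous g t) -> (forall t, C_continuous h t) ->
  (forall t, Cmod (g t) <= fst (h t)) -> Cmod (period_mean g) <= fst (period_mean h).
Proof.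
intros Hg Hh H. destruct (unit_rotation (period_mean g)) as [v [Hv E]].
replace (Cmod (period_mean g)) with (fst (v * period_mean g)%C) by (rewrite E; reflexivity).
rewrite <- period_mean_scal by exact Hg.
assert (Hvg : forall t, C_continuous (fun t => v * g t)%C t)
  by (intros t; apply C_continuous_mult; [apply C_continuous_const|apply Hg]).
apply period_mean_fst_le; [exact Hvg|exact Hh|].
intros t. eapply Rle_trans; [|apply H].
replace (Cmod (g t)) with (Cmod (v * g t)%C) by (rewrite Cmod_mult, Hv; ring).
eapply Rle_trans; [apply Rle_abs|]. apply re_le_Cmod.
Qed.

Lemma period_mean_conj g : (forall t, C_continuous g t) ->
  period_mean (fun t => Cconj (g t)) = Cconj (period_mean g).
Proof.
intros Hg. unfold period_mean, Cconj; simpl. f_equal.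
rewrite (RInt_opp (V:=R_CompleteNormedModule) (fun t => snd (g t))) by (apply ex_RInt_snd, Hg).
change opp with Ropp. field. apply PI_neq0.
Qed.

(** The fundamental theorem of calculus is applied to real parts only; the
    imaginary part of [g] is the real part of [- Ci * g]. *)
Lemma period_mean_derivative_zero (G g : R -> C) :
  (forall t, curve_diff G t (g t)) -> (forall t, C_continuous g t) -> G (2 * PI) = G 0 ->
    period_mean g = 0.
Proof.
intros HG Hg E. unfold period_mean.
assert (F : forall (G g : R -> C), (forall t, curve_diff G t (g t)) ->
  (forall t, C_continuous g t) -> G (2 * PI) = G 0 ->
   RInt (fun t => fst (g t)) 0 (2 * PI) = 0).
{ clear. intros G g HG Hg E.
  apply (is_RInt_unique (V:=R_CompleteNormedModule)).
  replace 0 with (minus (G:=R_AbelianGroup) (fst (G (2 * PI))) (fst (G 0))) at 2.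
  - apply (is_RInt_derive (V:=R_CompleteNormedModule) (fun t => fst (G t)) (fun t => fst (g t))).
    + intros x _. apply curve_diff_fst, HG.
    + intros x _. apply Hg.
  - rewrite E. apply (minus_eq_zero (G:=R_AbelianGroup)). }
rewrite (F G g HG Hg E).
replace (RInt (fun t => snd (g t)) 0 (2 * PI)) with (RInt (fun t => fst (- Ci * g t)%C) 0 (2 * PI)).
- rewrite (F (fun t => - Ci * G t)%C (fun t => - Ci * g t)%C).
  + unfold Rdiv. rewrite Rmult_0_l. reflexivity.
  + intros t. apply curve_diff_scal, HG.
  + intros t. apply C_continuous_mult; [apply C_continuous_const|apply Hg].
  + rewrite E. reflexivity.
- apply RInt_ext. intros t _. simpl. ring.
Qed.

Definition R2 : UniformSpace := prod_UniformSpace R_UniformSpace R_UniformSpace.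

Lemma C_continuous_section (h : R -> R -> C) s t :
  C_continuous (T:=R2) (fun p => h (fst p) (snd p)) (s, t) -> C_continuous (h s) t.
Proof.
intros [H1 H2].
assert (Hc : continuous (U:=R2) (fun t : R => (s, t)) t).
{ apply filterlim_locally. intros eps. exists eps. intros y Hy.
split; [apply ball_center|exact Hy]. }
split.
- exact (continuous_comp (U:=R_UniformSpace) (V:=R2) (W:=R_UniformSpace) (fun t : R => (s, t)) (fun p => fst (h (fst p) (snd p))) t Hc H1).
- exact (continuous_comp (U:=R_UniformSpace) (V:=R2) (W:=R_UniformSpace) (fun t : R => (s, t)) (fun p => snd (h (fst p) (snd p))) t Hc H2).
Qed.

Lemma C_continuous_snd (h : R -> C) s t : C_continuous h t ->
  C_continuous (T:=R2) (fun q => h (snd q)) (s, t).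
Proof.
intros [h1 h2]. split.
- apply (continuous_comp (U:=R2) (V:=R_UniformSpace) (W:=R_UniformSpace) snd (fun t => fst (h t)));
   [apply (continuous_snd (U:=R_UniformSpace) (V:=R_UniformSpace))|exact h1].
- apply (continuous_comp (U:=R2) (V:=R_UniformSpace) (W:=R_UniformSpace) snd (fun t => snd (h t)));
   [apply (continuous_snd (U:=R_UniformSpace) (V:=R_UniformSpace))|exact h2].
Qed.

(** Differentiation under the integral sign: the mean has derivative zero with
    respect to the parameter. The margin [eta] keeps the end points [0] and [1]
    interior, where two-sided derivatives make sense. *)
Lemma period_mean_parameter_constant (H dH : R -> R -> C) (eta : R) : 0 < eta ->
  (forall s t, - eta < s < 1 + eta -> curve_diff (fun u => H u t) s (dH s t)) ->
  (forall s t, - eta < s < 1 + eta -> C_continuous (H s) t) ->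
  (forall s t, - eta < s < 1 + eta -> C_continuous (T:=R2) (fun p => dH (fst p) (snd p)) (s, t)) ->
  (forall s, - eta < s < 1 + eta -> period_mean (dH s) = 0) ->
  period_mean (H 0) = period_mean (H 1).
Proof.
intros Heta.
assert (F : forall (H dH : R -> R -> C),
  (forall s t, - eta < s < 1 + eta -> curve_diff (fun u => H u t) s (dH s t)) ->
  (forall s t, - eta < s < 1 + eta -> C_continuous (H s) t) ->
  (forall s t, - eta < s < 1 + eta -> C_continuous (T:=R2) (fun p => dH (fst p) (snd p)) (s, t)) ->
  (forall s, - eta < s < 1 + eta -> period_mean (dH s) = 0) ->
  RInt (fun t => fst (H 0 t)) 0 (2*PI) = RInt (fun t => fst (H 1 t)) 0 (2*PI)).
{ clear H dH. intros H dH HD HC HdC H0.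
  apply (eq_is_derive (V:=R_NormedModule) (fun s => RInt (fun t => fst (H s t)) 0 (2*PI)) 0 1);
    [|lra].
  intros s Hs.
  assert (Hs' : - eta < s < 1 + eta) by lra.
  assert (Hloc : locally s (fun u => - eta < u < 1 + eta)).
  { apply (locally_interval _ s (- eta) (1 + eta)); [exact (proj1 Hs')|exact (proj2 Hs')|].
    intros y h1 h2; split; assumption. }
  assert (HDer : forall u t, - eta < u < 1 + eta -> Derive (fun z => fst (H z t)) u = fst (dH u t)).
  { intros u t Hu. apply is_derive_unique. apply (curve_diff_fst (fun z => H z t)), HD, Hu. }
  replace (@zero R_NormedModule) with (RInt (fun t => Derive (fun u => fst (H u t)) s) 0 (2 * PI)).
  - apply (is_derive_RInt_param (fun s t => fst (H s t)) 0 (2 * PI) s).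
    + revert Hloc. apply filter_imp. intros u Hu t _. exists (fst (dH u t)).
      apply (curve_diff_fst (fun z => H z t)), HD, Hu.
    + intros t _. apply (continuity_2d_pt_ext_loc (fun u v => fst (dH u v))).
      * destruct Hloc as [d Hd]. exists d. intros u v Hu Hv. symmetry. apply HDer. apply Hd.
      exact Hu.
      * apply continuity_2d_pt_filterlim. exact (proj1 (HdC s t Hs')).
    + revert Hloc. apply filter_imp. intros u Hu. apply ex_RInt_fst. intros t. apply HC, Hu.
  - transitivity (RInt (fun t => fst (dH s t)) 0 (2 * PI)).
    + apply RInt_ext. intros t _. apply HDer, Hs'.
    + pose proof (f_equal fst (H0 s Hs')) as E. simpl in E. pose proof PI_RGT_0.
      replace (RInt (fun t => fst (dH s t)) 0 (2 * PI)) with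
        (RInt (fun t => fst (dH s t)) 0 (2 * PI) / (2 * PI) * (2 * PI)) by (field; lra).
      rewrite E. apply Rmult_0_l. }
intros HD HC HdC H0.
assert (F1 := F H dH HD HC HdC H0).
assert (F2 : RInt (fun t => fst (- Ci * H 0 t)%C) 0 (2*PI) = RInt (fun t => fst (- Ci * H 1 t)%C) 0 (2*PI)).
{ apply (F (fun s t => - Ci * H s t)%C (fun s t => - Ci * dH s t)%C).
  - intros s t Hs. apply (curve_diff_scal (- Ci) (fun u => H u t)), HD, Hs.
  - intros s t Hs. apply C_continuous_mult; [apply C_continuous_const|apply HC, Hs].
  - intros s t Hs. apply C_continuous_mult; [apply C_continuous_const|apply HdC, Hs].
  - intros s Hs. rewrite period_mean_scal; [rewrite H0 by exact Hs; ring|].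
    intros t. apply C_continuous_section, HdC, Hs. }
unfold period_mean. rewrite F1. f_equal. f_equal.
transitivity (RInt (fun t => fst (- Ci * H 0 t)%C) 0 (2*PI)); [apply RInt_ext; intros t _; simpl;
  ring|].
rewrite F2. apply RInt_ext; intros t _; simpl; ring.
Qed.

(** * The Cauchy integral formula *)

(** With [zeta = r * unit_circle t] this is [zeta / (zeta - z)], so that its product
    with [dt / (2 pi)] is the Cauchy kernel [dzeta / (2 pi i (zeta - z))]. *)
Definition cauchy_kernel (r : R) (z : C) (t : R) : C :=
  (RtoC r * unit_circle t / (RtoC r * unit_circle t - z))%C.

Lemma circle_minus_neq0 r z t : Cmod z < r -> (RtoC r * unit_circle t - z)%C <> 0.
Proof.
intros Hz Ez. apply Ceq_minus in Ez.
pose proof (Cmod_ge_0 z).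
assert (Em : Cmod (RtoC r * unit_circle t)%C = r)
  by (rewrite Cmod_mult, Cmod_R, Cmod_unit_circle, Rabs_pos_eq; lra).
rewrite Ez in Em. lra.
Qed.

(** Shrink the circle [zeta] to the centre [z] along [w s = z + s (zeta - z)] and
    follow the mean of [F (w s) * zeta / (zeta - z)]. Its derivative in [s] is the
    mean of [F' (w s) * zeta], and [i s F' (w s) * zeta] is the derivative of
    [F (w s)] in [t], which has mean zero by periodicity. So the mean is the same
    for [s = 1] and for [s = 0]. *)
Lemma cauchy_integral (F : C -> C) (r : R) (z : C) : analytic_on_disk F -> Cmod z < r < 1 ->
  period_mean (fun t => F (RtoC r * unit_circle t) * cauchy_kernel r z t)%C = (F z * period_mean (cauchy_kernel r z))%C.
Proof.
intros HF [Hz Hr].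
pose proof (Cmod_ge_0 z) as Hz0.
set (k := cauchy_kernel r z).
set (p := fun t => (RtoC r * unit_circle t - z)%C).
assert (Hp0 : forall t, p t <> 0) by (intros t; apply circle_minus_neq0, Hz).
assert (Hcirc : forall t, C_continuous (fun t => RtoC r * unit_circle t)%C t)
  by (intros t; apply C_continuous_mult; [apply C_continuous_const|apply unit_circle_continuous]).
assert (Hpc : forall t, C_continuous p t)
  by (intros t; apply C_continuous_minus; [apply Hcirc|apply C_continuous_const]).
assert (Hkc : forall t, C_continuous k t).
{ intros t. apply C_continuous_mult; [apply Hcirc|].
apply C_continuous_inv; [apply Hp0|apply Hpc]. }
set (w := fun s t => (z + RtoC s * p t)%C).
(* For [s] within [eta] of the unit interval, [|w s t|] is at most
   [(1 + 2 eta) r = 1 - (1 - r)^2]. *)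
set (eta := (1 - r) / 2).
assert (Hin : forall s t, - eta < s < 1 + eta -> unit_disk (w s t)).
{ intros s t Hs. unfold unit_disk, w, p, eta in *.
  replace (z + RtoC s * (RtoC r * unit_circle t - z))%C
    with (RtoC (1 - s) * z + RtoC s * (RtoC r * unit_circle t))%C
   by (rewrite RtoC_minus; ring).
  eapply Rle_lt_trans; [apply Cmod_triangle|].
  rewrite !Cmod_mult, !Cmod_R, Cmod_unit_circle, (Rabs_pos_eq r) by lra. rewrite Rmult_1_r.
  apply Rle_lt_trans with ((Rabs (1 - s) + Rabs s) * r).
  - rewrite Rmult_plus_distr_r. apply Rplus_le_compat_r, Rmult_le_compat_l; [apply Rabs_pos|lra].
  - apply Rle_lt_trans with ((1 + (1 - r)) * r); [|nra].
    apply Rmult_le_compat_r; [lra|]. unfold Rabs.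
    destruct (Rcase_abs (1 - s)); destruct (Rcase_abs s); lra. }
assert (Hw2 : forall s t, C_continuous (T:=R2) (fun q => w (fst q) (snd q)) (s, t)).
{ intros s t. apply C_continuous_plus; [apply C_continuous_const|]. apply C_continuous_mult.
  - split; [|apply continuous_const].
  apply (continuous_fst (U:=R_UniformSpace) (V:=R_UniformSpace)).
  - apply (C_continuous_snd p), Hpc. }
assert (Hcomp2 : forall s t, - eta < s < 1 + eta -> forall G : C -> C,
   (forall u, unit_disk u -> forall eps, 0 < eps -> exists d, 0 < d /\
    forall v, Cmod (v - u)%C < d -> Cmod (G v - G u)%C < eps) ->
   C_continuous (T:=R2) (fun q => G (w (fst q) (snd q))) (s, t)).
{ intros s t Hs G HG. apply (C_continuous_comp G (fun q : R2 => w (fst q) (snd q)));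
  [apply Hw2|]. apply HG. apply Hin, Hs. }
assert (HdF := analytic_derive_continuous F HF).
assert (HFc : forall u, unit_disk u -> forall eps, 0 < eps -> exists d, 0 < d /\
    forall v, Cmod (v - u)%C < d -> Cmod (F v - F u)%C < eps).
{ intros u Hu. apply (C_diff_continuous F u (C_derive F u)), analytic_C_diff; assumption. }
assert (Hmain : period_mean (fun t => F (w 0 t) * k t)%C = period_mean (fun t => F (w 1 t) * k t)%C).
{ apply (period_mean_parameter_constant (fun s t => F (w s t) * k t)%C
    (fun s t => C_derive F (w s t) * (RtoC r * unit_circle t))%C eta).
  - unfold eta; lra.
  - intros s t Hs.
    replace (C_derive F (w s t) * (RtoC r * unit_circle t))%C
      with (k t * (C_derive F (w s t) * p t))%C.
    2:{ unfold k, cauchy_kernel. fold (p t). field. apply Hp0. }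
    assert (HH : curve_diff (fun u => k t * F (w u t))%C s (k t * (C_derive F (w s t) * p t))%C).
    { apply (curve_diff_scal (k t) (fun u => F (w u t))).
      apply (curve_diff_comp F (fun u => w u t)); [apply analytic_C_diff;
        [exact HF|apply Hin, Hs]|].
      intros eps He. exists (mkposreal 1 Rlt_0_1). intros y _. unfold w.
      replace (z + RtoC y * p t - (z + RtoC s * p t) - RtoC (y - s) * p t)%C with (RtoC 0)
        by (rewrite RtoC_minus; ring).
      rewrite Cmod_0. apply Rmult_le_pos; [lra|apply Rabs_pos]. }
    intros eps He. generalize (HH eps He). apply filter_imp. intros y.
    rewrite (Cmult_comm (k t) (F (w y t))), (Cmult_comm (k t) (F (w s t))). trivial.
  - intros s t Hs. apply C_continuous_mult; [|apply Hkc].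
    apply (C_continuous_section (fun s t => F (w s t))). apply Hcomp2; [exact Hs|exact HFc].
  - intros s t Hs. apply C_continuous_mult; [apply Hcomp2; [exact Hs|exact HdF]|].
    apply (C_continuous_snd (fun t => RtoC r * unit_circle t)%C), Hcirc.
  - intros s Hs.
    assert (Hcs : forall t, C_continuous (fun t => C_derive F (w s t) * (RtoC r * unit_circle t))%C t).
    { intros t. apply C_continuous_mult; [|apply Hcirc].
    apply (C_continuous_section (fun s t => C_derive F (w s t))).
      apply Hcomp2; [exact Hs|exact HdF]. }
    (* At [s = 0] the antiderivative cannot be divided by [s], but the integrand
       is then a multiple of [unit_circle]. *)
    destruct (Req_dec s 0) as [->|Hs0].
    + apply (period_mean_derivative_zero (fun t => (- Ci * (C_derive F z * RtoC r)) * unit_circle t)%C); [|exact Hcs|].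
      * intros t.
        replace (C_derive F (w 0 t) * (RtoC r * unit_circle t))%C with
          ((- Ci * (C_derive F z * RtoC r)) * (Ci * unit_circle t))%C.
        -- apply curve_diff_scal, unit_circle_diff.
        -- replace (w 0 t) with z by (unfold w; ring).
           transitivity (- (Ci * Ci) * (C_derive F z * (RtoC r * unit_circle t)))%C; [ring|].
           replace (Ci * Ci)%C with (RtoC (-1))
             by (unfold Ci, Cmult, RtoC; simpl; f_equal; ring). ring.
      * unfold unit_circle. rewrite cos_2PI, sin_2PI, cos_0, sin_0. reflexivity.
    + assert (Hs1 : RtoC s <> 0) by (intros E; apply RtoC_inj in E; contradiction).
      apply (period_mean_derivative_zero (fun t => (- Ci / RtoC s) * F (w s t))%C); [|exact Hcs|].
      * intros t.
        replace (C_derive F (w s t) * (RtoC r * unit_circle t))%C with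
          ((- Ci / RtoC s) * (C_derive F (w s t) * ((RtoC s * RtoC r) * (Ci * unit_circle t))))%C.
        -- apply (curve_diff_scal (- Ci / RtoC s) (fun t => F (w s t))).
           apply (curve_diff_comp F (fun t => w s t)); [apply analytic_C_diff;
             [exact HF|apply Hin, Hs]|].
           intros eps He. generalize (curve_diff_scal (RtoC s * RtoC r) _ _ _ (unit_circle_diff t) eps He).
           apply filter_imp. intros y Hy. eapply Rle_trans; [|exact Hy]. right. f_equal.
           unfold w, p. ring.
        -- transitivity (- (Ci * Ci) * (C_derive F (w s t) * (RtoC r * unit_circle t)))%C;
          [field; exact Hs1|].
           replace (Ci * Ci)%C with (RtoC (-1))
             by (unfold Ci, Cmult, RtoC; simpl; f_equal; ring). ring.
      * unfold w, p, unit_circle. rewrite cos_2PI, sin_2PI, cos_0, sin_0. reflexivity. }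
rewrite <- period_mean_scal by exact Hkc.
transitivity (period_mean (fun t => F (w 1 t) * k t)%C).
- apply period_mean_ext. intros t. unfold w, p. f_equal. f_equal. ring.
- rewrite <- Hmain. apply period_mean_ext. intros t. unfold w. f_equal. f_equal. ring.
Qed.



Lemma circle_continuous r t : C_continuous (fun t => RtoC r * unit_circle t)%C t.
Proof. apply C_continuous_mult; [apply C_continuous_const|apply unit_circle_continuous]. Qed.

Lemma Cmod_circle r t : 0 <= r -> Cmod (RtoC r * unit_circle t)%C = r.
Proof. intros Hr. rewrite Cmod_mult, Cmod_R, Cmod_unit_circle, Rabs_pos_eq; lra. Qed.

Lemma circle_neq0 r t : 0 < r -> (RtoC r * unit_circle t)%C <> 0.
Proof. intros Hr E. pose proof (Cmod_circle r t (Rlt_le _ _ Hr)) as H. rewrite E, Cmod_0 in H.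
lra. Qed.

Lemma inv_circle_continuous r t : 0 < r -> C_continuous (fun t => / (RtoC r * unit_circle t))%C t.
Proof. intros Hr. apply C_continuous_inv; [apply circle_neq0, Hr|apply circle_continuous]. Qed.

Lemma cauchy_kernel_continuous r z t : Cmod z < r -> C_continuous (cauchy_kernel r z) t.
Proof.
intros Hz. apply C_continuous_mult; [apply circle_continuous|].
apply C_continuous_inv; [apply circle_minus_neq0, Hz|].
apply C_continuous_minus; [apply circle_continuous|apply C_continuous_const].
Qed.

Lemma Cmod_cauchy_kernel_le r z t : Cmod z < r -> Cmod (cauchy_kernel r z t) <= r / (r - Cmod z).
Proof.
intros Hz. pose proof (Cmod_ge_0 z). unfold cauchy_kernel.
rewrite Cmod_div by (apply circle_minus_neq0, Hz).
rewrite Cmod_circle by lra. apply Rmult_le_compat_l; [lra|]. apply Rinv_le_contravar; [lra|].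
assert (E : (RtoC r * unit_circle t)%C = ((RtoC r * unit_circle t - z) + z)%C) by ring.
pose proof (Cmod_circle r t ltac:(lra)) as H1. rewrite E in H1.
pose proof (Cmod_triangle (RtoC r * unit_circle t - z)%C z). lra.
Qed.

(** Expand [zeta / (zeta - z)] as a finite geometric sum in [z / zeta] with its exact
    remainder [(z / zeta)^(n+1) * zeta / (zeta - z)]. The partial sums of the series
    then differ from the limit by the mean of the remainder, which tends to zero;
    no interchange of sum and integral is involved. *)
Lemma cauchy_kernel_pseries (g : R -> C) (M r : R) (z : C) :
  (forall t, C_continuous g t) -> (forall t, Cmod (g t) <= M) -> Cmod z < r ->
  is_pseries (fun n => period_mean (fun t => g t * (/ (RtoC r * unit_circle t)) ^ n)%C) z
    (period_mean (fun t => g t * cauchy_kernel r z t)%C).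
Proof.
intros Hg HM Hz. pose proof (Cmod_ge_0 z) as Hz0. assert (Hr : 0 < r) by lra.
set (k := cauchy_kernel r z).
set (q := fun t => (z / (RtoC r * unit_circle t))%C).
assert (Hk : forall t, C_continuous k t) by (intros t; apply cauchy_kernel_continuous, Hz).
assert (Hq : forall t, C_continuous q t)
  by (intros t; apply C_continuous_mult;
    [apply C_continuous_const|apply inv_circle_continuous, Hr]).
assert (Hgk : forall t, C_continuous (fun t => g t * k t)%C t)
  by (intros t; apply C_continuous_mult; auto).
assert (Hgkq : forall n t, C_continuous (fun t => g t * k t * q t ^ n)%C t).
{ intros n t. apply C_continuous_mult; [apply Hgk|apply C_continuous_pow, Hq]. }
assert (Hterm : forall n t, (z ^ n * (g t * (/ (RtoC r * unit_circle t)) ^ n))%C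
   = (g t * k t * q t ^ n + (RtoC (-1)) * (g t * k t * q t ^ S n))%C).
{ intros n t. pose proof (circle_minus_neq0 r z t Hz) as Hp. pose proof (circle_neq0 r t Hr) as HZ.
  unfold k, q, cauchy_kernel. simpl Cpow. set (Z := (RtoC r * unit_circle t)%C) in *.
  replace ((z / Z) ^ n)%C with (z ^ n * (/ Z) ^ n)%C by (rewrite <- Cpow_mult_l; reflexivity).
  field. split; assumption. }
assert (S1 : forall n, sum_n (G:=C_AbelianGroup) (fun n => period_mean (fun t => g t * (/ (RtoC r * unit_circle t)) ^ n)%C * z ^ n)%C n
   = (period_mean (fun t => g t * k t)%C - period_mean (fun t => g t * k t * q t ^ S n)%C)%C).
{ assert (T : forall n, (period_mean (fun t => g t * (/ (RtoC r * unit_circle t)) ^ n)%C * z ^ n)%C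
     = (period_mean (fun t => g t * k t * q t ^ n)%C - period_mean (fun t => g t * k t * q t ^ S n)%C)%C).
  { intros n. rewrite Cmult_comm. rewrite <- period_mean_scal.
    2:{ intros t. apply C_continuous_mult;
      [apply Hg|apply C_continuous_pow, inv_circle_continuous, Hr]. }
    rewrite (period_mean_ext _ _ (Hterm n)).
    rewrite period_mean_plus, period_mean_scal; [ring|apply Hgkq|apply Hgkq|].
    intros t. apply C_continuous_mult; [apply C_continuous_const|apply Hgkq]. }
  induction n as [|n IH].
  - rewrite sum_O, T. f_equal. apply period_mean_ext. intros t. simpl. ring.
  - rewrite sum_Sn, IH, T. change plus with Cplus. ceq. ring. }
apply is_pseries_C, is_series_C_spec. intros eps He.
set (K := M * (r / (r - Cmod z))).
assert (HM0 : 0 <= M) by (eapply Rle_trans; [apply Cmod_ge_0|apply (HM 0)]).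
assert (HK : 0 <= K) by (apply Rmult_le_pos; [exact HM0|apply Rdiv_le_0_compat; lra]).
destruct (pow_lt_1_zero (Cmod z / r)) with (y := eps / (K + 1)) as [N HN].
{ rewrite Rabs_pos_eq; [apply Rlt_div_l; lra|apply Rdiv_le_0_compat; lra]. }
{ apply Rdiv_lt_0_compat; lra. }
exists N. intros n Hn. rewrite S1. fold k.
replace (period_mean (fun t => g t * k t) - period_mean (fun t => g t * k t * q t ^ S n) - period_mean (fun t => g t * k t))%C
  with (- period_mean (fun t => g t * k t * q t ^ S n))%C by ring.
rewrite Cmod_opp. set (Q := Cmod z / r) in *.
assert (HQ0 : 0 <= Q ^ S n) by (apply pow_le; apply Rdiv_le_0_compat; lra).
apply Rle_lt_trans with (K * Q ^ S n).
- replace (K * Q ^ S n) with (fst (period_mean (fun _ => RtoC (K * Q ^ S n))))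
  by (rewrite period_mean_const; reflexivity).
  apply Cmod_period_mean_le; [apply Hgkq|intros t; apply C_continuous_const|].
  intros t. simpl fst. rewrite !Cmod_mult, Cmod_pow. unfold q at 1.
  rewrite Cmod_div by (apply circle_neq0, Hr).
  rewrite Cmod_circle by lra. fold Q. apply Rmult_le_compat_r; [exact HQ0|].
  apply Rmult_le_compat; try apply Cmod_ge_0; [apply HM|apply Cmod_cauchy_kernel_le, Hz].
- specialize (HN (S n) ltac:(lia)). rewrite Rabs_pos_eq in HN by exact HQ0.
  apply (Rmult_lt_compat_l (K + 1)) in HN; [|lra].
  replace ((K + 1) * (eps / (K + 1))) with eps in HN by (field; lra). nra.
Qed.

(** At the centre [z = 0] the Cauchy kernel is constantly [1], so this is the
    Cauchy formula for [z^m * f z]. *)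
Lemma period_mean_circle_nonneg_power f r m : analytic_on_disk f -> 0 < r < 1 ->
  period_mean (fun t => (RtoC r * unit_circle t) ^ m * f (RtoC r * unit_circle t))%C = (0 ^ m * f 0)%C.
Proof.
intros Hf Hr.
assert (H0 : Cmod 0 < r < 1) by (rewrite Cmod_0; lra).
pose proof (cauchy_integral _ r 0 (analytic_mult_pow f m Hf) H0) as H.
assert (K1 : forall t, cauchy_kernel r 0 t = RtoC 1).
{ intros t. unfold cauchy_kernel.
replace (RtoC r * unit_circle t - 0)%C with (RtoC r * unit_circle t)%C by ring.
  apply Cinv_r, circle_neq0. lra. }
rewrite (period_mean_ext (cauchy_kernel r 0) _ K1), period_mean_const, Cmult_1_r in H.
rewrite <- H. apply period_mean_ext. intros t. rewrite K1. ring.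
Qed.

Lemma period_mean_unit_circle_pow m : period_mean (fun t => unit_circle t ^ S m)%C = 0.
Proof.
assert (Hr : 0 < 1/2 < 1) by lra.
pose proof (period_mean_circle_nonneg_power (fun _ => RtoC 1) (1/2) (S m) (analytic_const 1) Hr) as H.
assert (Hc : RtoC (1/2) <> 0) by (intros E; apply RtoC_inj in E; lra).
rewrite (period_mean_ext _ (fun t => RtoC (1/2) ^ S m * unit_circle t ^ S m)%C) in H
  by (intros t; rewrite Cpow_mult_l; ring).
rewrite period_mean_scal in H by (intros t; apply C_continuous_pow, unit_circle_continuous).
assert (H' : (RtoC (1/2) ^ S m * period_mean (fun t => unit_circle t ^ S m))%C = 0)
  by (rewrite H; simpl; ring).
apply (Cmult_eq_0_reg_l _ _ (Cpow_nz (RtoC (1/2)) (S m) Hc) H').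
Qed.

(** The Cauchy formula leaves this mean as a factor. For the constant function [1],
    the expansion of the kernel has coefficients [1, 0, 0, ...], so its sum is [1]. *)
Lemma period_mean_cauchy_kernel r z : Cmod z < r -> period_mean (cauchy_kernel r z) = 1.
Proof.
intros Hz. pose proof (Cmod_ge_0 z).
assert (H1 := cauchy_kernel_pseries (fun _ => RtoC 1) 1 r z (fun t => C_continuous_const 1 t)
   (fun _ => Req_le _ _ Cmod_1) Hz).
assert (H2 : is_pseries (fun n => period_mean (fun t => 1 * (/ (RtoC r * unit_circle t)) ^ n)%C) z (RtoC 1)).
{ apply (is_pseries_ext (K:=C_AbsRing) (V:=C_NormedModule) (fun n => 1 * 0 ^ n)%C);
  [|apply constant_pseries].
  intros [|n].
  - symmetry. exact (period_mean_const (1 * 1)%C).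
  - assert (Hcc : forall t, C_continuous (fun t => unit_circle t ^ S n)%C t)
    by (intros t; apply C_continuous_pow, unit_circle_continuous).
    rewrite (period_mean_ext _ (fun t => (/ RtoC r) ^ S n * Cconj (unit_circle t ^ S n))%C).
    + rewrite period_mean_scal, period_mean_conj, period_mean_unit_circle_pow; [|exact Hcc|].
      * replace (Cconj 0) with (RtoC 0) by (unfold Cconj, RtoC; simpl; f_equal; ring). simpl.
      ceq. ring.
      * intros t. apply (C_continuous_ext (fun t => (/ unit_circle t) ^ S n)%C).
        -- intros u. rewrite Cpow_conj, inv_unit_circle. reflexivity.
        -- apply C_continuous_pow, C_continuous_inv;
          [apply unit_circle_neq0|apply unit_circle_continuous].
    + intros t. rewrite Cpow_conj, <- inv_unit_circle, <- Cpow_mult_l.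
      rewrite Cmult_1_l. f_equal. field. split; [apply unit_circle_neq0|].
      intros E; apply RtoC_inj in E; lra. }
assert (H3 := filterlim_locally_unique (K:=C_AbsRing) (V:=C_NormedModule) _ _ _ H1 H2).
rewrite <- H3. apply period_mean_ext. intros t. ring.
Qed.

Lemma analytic_circle_continuous f r t : analytic_on_disk f -> 0 < r < 1 ->
  C_continuous (fun t => f (RtoC r * unit_circle t)%C) t.
Proof.
intros Hf Hr. apply (C_continuous_comp f (fun t => RtoC r * unit_circle t)%C);
  [apply circle_continuous|].
apply (C_diff_continuous f _ (C_derive f (RtoC r * unit_circle t)%C)), analytic_C_diff; [exact Hf|].
unfold unit_disk. rewrite Cmod_circle; lra.
Qed.

(** * Coefficients of functions bounded by one *)

(** The Taylor coefficient at [0] computed by the Cauchy formula on the circle of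
    radius [r]. *)
Definition circle_coeff (f : C -> C) (r : R) (n : nat) : C :=
  period_mean (fun t => f (RtoC r * unit_circle t) * (/ (RtoC r * unit_circle t)) ^ n)%C.

(** The Cauchy formula on the circle of radius [r] expands [f] on the disk of
    radius [r]. All these expansions agree near [0], so their coefficients agree
    and give one expansion on the whole disk. *)
Lemma unit_ball_expansion f : unit_ball_analytic f ->
  exists a : nat -> C, (forall z, unit_disk z -> is_pseries a z (f z)) /\
    forall r n, 0 < r < 1 -> circle_coeff f r n = a n.
Proof.
intros [Hf Hb].
set (c := circle_coeff f).
assert (Hc : forall r z, 0 < r < 1 -> Cmod z < r -> is_pseries (c r) z (f z)).
{ intros r z Hr Hz.
  assert (H : is_pseries (c r) z (period_mean (fun t => f (RtoC r * unit_circle t) * cauchy_kernel r z t)%C)).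
  { apply (cauchy_kernel_pseries (fun t => f (RtoC r * unit_circle t)%C) 1); [| |exact Hz].
    - intros t. apply analytic_circle_continuous; assumption.
    - intros t. apply Hb. unfold unit_disk. rewrite Cmod_circle; lra. }
  rewrite cauchy_integral in H by (try assumption; lra).
  rewrite period_mean_cauchy_kernel, Cmult_1_r in H by exact Hz. exact H. }
assert (Hu : forall r n, 0 < r < 1 -> c r n = c (1/2) n).
{ intros r n Hr. apply (power_series_unique _ _ f (Rmin r (1/2))).
  - apply Rmin_pos; lra.
  - intros z Hz. apply Hc; [exact Hr|]. eapply Rlt_le_trans; [exact Hz|apply Rmin_l].
  - intros z Hz. apply Hc; [lra|]. eapply Rlt_le_trans; [exact Hz|apply Rmin_r]. }
exists (c (1/2)). split; [|intros r n Hr; exact (Hu r n Hr)].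
intros z Hz. unfold unit_disk in Hz. pose proof (Cmod_ge_0 z).
set (r := (Cmod z + 1) / 2).
assert (Hr : 0 < r < 1) by (unfold r; lra).
apply (is_pseries_ext (K:=C_AbsRing) (V:=C_NormedModule) (c r)); [intros n; apply Hu, Hr|].
apply Hc; [exact Hr|unfold r; lra].
Qed.

(** Let [A k = r^k a k] and [e = unit_circle t], and take the mean over the circle of
    [f * v e^-(m+2) * (1 + y e^(m+1))^2] with [|v| = 1]. Expanding the square, it
    equals [v A (m+2) + 2 v y A 1], because [f] has no coefficients of index at most
    zero. As [|f| <= 1], its modulus is at most the mean of [|1 + y e^(m+1)|^2], which
    is [1 + |y|^2]. Choosing [v] to make the first term [|A (m+2)|] and [y] to make
    the second [2 |A 1|^2], with [|y| = |A 1|], gives [|A (m+2)| + |A 1|^2 <= 1]; then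
    let [r] tend to [1]. *)
Lemma unit_ball_coefficient_bound f (a : nat -> C) : unit_ball_analytic f -> f 0 = 0 ->
  (forall r n, 0 < r < 1 -> circle_coeff f r n = a n) ->
  forall m, Cmod (a (S (S m))) <= 1 - Cmod (a 1%nat) ^ 2.
Proof.
intros [Hf Hb] Hf0 Ha m.
set (X := Cmod (a (S (S m)))). set (Y := Cmod (a 1%nat)).
assert (HX : 0 <= X) by apply Cmod_ge_0. assert (HY : 0 <= Y) by apply Cmod_ge_0.
assert (Main : forall r, 0 < r < 1 -> r ^ S (S m) * X + (r * Y) ^ 2 <= 1).
{ intros r Hr.
  assert (Hrc : RtoC r <> 0) by (intros E; apply RtoC_inj in E; lra).
  set (A := fun n => (RtoC r ^ n * a n)%C).
  set (fc := fun t => f (RtoC r * unit_circle t)%C).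
  assert (Hfc : forall t, C_continuous fc t)
    by (intros t; apply analytic_circle_continuous; assumption).
  assert (HI : forall t, C_continuous (fun t => / unit_circle t)%C t)
    by (intros t; apply C_continuous_inv; [apply unit_circle_neq0|apply unit_circle_continuous]).
  assert (Hneg : forall n t, C_continuous (fun t => fc t * (/ unit_circle t) ^ n)%C t)
    by (intros n t; apply C_continuous_mult; [apply Hfc|apply C_continuous_pow, HI]).
  assert (Hpos : forall n t, C_continuous (fun t => fc t * unit_circle t ^ n)%C t)
    by (intros n t; apply C_continuous_mult;
      [apply Hfc|apply C_continuous_pow, unit_circle_continuous]).
  assert (HA : forall n, period_mean (fun t => fc t * (/ unit_circle t) ^ n)%C = A n).
  { intros n. unfold A. rewrite <- (Ha r n Hr). unfold circle_coeff. rewrite <- period_mean_scal.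
    - apply period_mean_ext. intros t. fold (fc t).
      transitivity (fc t * (RtoC r ^ n * (/ (RtoC r * unit_circle t)) ^ n))%C; [|ring].
      rewrite <- Cpow_mult_l. f_equal. f_equal. field. split; [apply unit_circle_neq0|exact Hrc].
    - intros t. apply C_continuous_mult;
      [apply Hfc|apply C_continuous_pow, inv_circle_continuous; lra]. }
  assert (HP : forall n, period_mean (fun t => fc t * unit_circle t ^ n)%C = 0).
  { intros n. pose proof (period_mean_circle_nonneg_power f r n Hf Hr) as H.
  rewrite Hf0, Cmult_0_r in H.
    rewrite (period_mean_ext _ (fun t => RtoC r ^ n * (fc t * unit_circle t ^ n))%C) in H
      by (intros t; rewrite Cpow_mult_l; fold (fc t); ring).
    rewrite period_mean_scal in H by apply Hpos.
    exact (Cmult_eq_0_reg_l _ _ (Cpow_nz (RtoC r) n Hrc) H). }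
  destruct (unit_rotation (A (S (S m)))) as [v [Hv EA]].
  assert (Hvv : (v * Cconj v)%C = 1) by (rewrite Cmult_comm, Cconj_mult_self, Hv; f_equal; ring).
  set (y := (Cconj v * Cconj (A 1%nat))%C).
  assert (Hy : Cmod y = Cmod (A 1%nat)) by (unfold y; rewrite Cmod_mult, !Cmod_conj, Hv; ring).
  assert (HvyA : (v * y * A 1%nat)%C = RtoC (Cmod (A 1%nat) ^ 2)).
  { rewrite <- Cconj_mult_self. unfold y.
    transitivity ((v * Cconj v) * (Cconj (A 1%nat) * A 1%nat))%C; [ring|]. rewrite Hvv. ring. }
  set (g1 := fun t => (v * (fc t * (/ unit_circle t) ^ S (S m)))%C).
  set (g2 := fun t => ((RtoC 2 * v * y) * (fc t * (/ unit_circle t) ^ 1))%C).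
  set (g3 := fun t => ((v * y ^ 2) * (fc t * unit_circle t ^ m))%C).
  set (g := fun t => (g1 t + g2 t + g3 t)%C).
  assert (Hg1 : forall t, C_continuous g1 t)
    by (intros t; exact (C_continuous_mult _ _ _ (C_continuous_const _ _) (Hneg _ _))).
  assert (Hg2 : forall t, C_continuous g2 t)
    by (intros t; exact (C_continuous_mult _ _ _ (C_continuous_const _ _) (Hneg _ _))).
  assert (Hg3 : forall t, C_continuous g3 t)
    by (intros t; exact (C_continuous_mult _ _ _ (C_continuous_const _ _) (Hpos _ _))).
  assert (Hg12 : forall t, C_continuous (fun t => g1 t + g2 t)%C t)
    by (intros t; exact (C_continuous_plus _ _ _ (Hg1 t) (Hg2 t))).
  assert (Hg : forall t, C_continuous g t)
    by (intros t; exact (C_continuous_plus _ _ _ (Hg12 t) (Hg3 t))).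
  assert (Eg : period_mean g = RtoC (Cmod (A (S (S m))) + 2 * Cmod (A 1%nat) ^ 2)).
  { assert (E1 : period_mean g1 = (v * A (S (S m)))%C)
    by (unfold g1; rewrite period_mean_scal, HA by apply Hneg; reflexivity).
    assert (E2 : period_mean g2 = (RtoC 2 * v * y * A 1%nat)%C)
      by (unfold g2; rewrite period_mean_scal, HA by apply Hneg; reflexivity).
    assert (E3 : period_mean g3 = 0)
      by (unfold g3; rewrite period_mean_scal, HP by apply Hpos; ring).
    assert (E12 : period_mean (fun t => g1 t + g2 t)%C = (period_mean g1 + period_mean g2)%C) by exact (period_mean_plus _ _ Hg1 Hg2).
    transitivity (period_mean (fun t => g1 t + g2 t) + period_mean g3)%C;
      [exact (period_mean_plus _ _ Hg12 Hg3)|].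
    rewrite E12, E1, E2, E3.
    rewrite RtoC_plus, RtoC_mult, <- HvyA, <- EA. ring. }
  set (h := fun t => (RtoC (1 + Cmod y ^ 2) + (RtoC 2 * y) * unit_circle t ^ S m)%C).
  assert (Hh : forall t, C_continuous h t).
  { intros t. apply C_continuous_plus; [apply C_continuous_const|].
  apply C_continuous_mult; [apply C_continuous_const|apply C_continuous_pow, unit_circle_continuous]. }
  assert (Eh : period_mean h = RtoC (1 + Cmod y ^ 2)).
  { unfold h. rewrite period_mean_plus, period_mean_scal, period_mean_const, period_mean_unit_circle_pow; [ring| | |].
    - intros t; apply C_continuous_pow, unit_circle_continuous.
    - intros t; apply C_continuous_const.
    - intros t. apply C_continuous_mult;
      [apply C_continuous_const|apply C_continuous_pow, unit_circle_continuous]. }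
  assert (Hgh : forall t, Cmod (g t) <= fst (h t)).
  { intros t. set (u := (y * unit_circle t ^ S m)%C).
    assert (E : g t = (fc t * (v * (/ unit_circle t) ^ S (S m)) * (1 + u) ^ 2)%C).
    { unfold g, g1, g2, g3, u.
      assert (W : (unit_circle t ^ m * (/ unit_circle t) ^ m)%C = 1).
      { rewrite <- Cpow_mult_l, Cinv_r by apply unit_circle_neq0. apply Cpow_1_l. }
      simpl Cpow in *.
      set (e := unit_circle t) in *. set (P := (e ^ m)%C) in *. set (Q := ((/ e) ^ m)%C) in *.
      assert (He : (e * / e)%C = 1) by (apply Cinv_r, unit_circle_neq0). set (i := (/ e)%C) in *.
      transitivity (fc t * v * (i * i * Q + 2 * y * i * (P * Q) * (e * i) + y * y * P * (P * Q) * (e * i) * (e * i)))%C.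
      - rewrite W, He. ring.
      - ring. }
    rewrite E, !Cmod_mult, !Cmod_pow, Hv, Cmod_inv, Cmod_unit_circle by apply unit_circle_neq0.
    rewrite Rinv_1, pow1, !Rmult_1_r.
    assert (Hf1 : Cmod (fc t) <= 1) by (apply Hb; unfold unit_disk; rewrite Cmod_circle; lra).
    apply Rle_trans with (Cmod (1 + u)%C ^ 2).
    - rewrite <- (Rmult_1_l (Cmod (1 + u)%C ^ 2)) at 2.
    apply Rmult_le_compat_r; [apply pow2_ge_0|exact Hf1].
    - right. assert (Hu : Cmod y = Cmod u)
      by (unfold u; rewrite Cmod_mult, Cmod_pow, Cmod_unit_circle, pow1; ring).
      replace (h t) with (RtoC (1 + Cmod u ^ 2) + RtoC 2 * u)%C
        by (unfold h, u in *; rewrite <- Hu; ring).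
      rewrite !Cmod2_alt. destruct u as [u1 u2]. simpl. ring. }
  pose proof (Cmod_period_mean_le g h Hg Hh Hgh) as H.
  rewrite Eg, Eh, Hy, Cmod_R in H.
  change (fst (RtoC (1 + Cmod (A 1%nat) ^ 2))) with (1 + Cmod (A 1%nat) ^ 2) in H.
  assert (EA1 : Cmod (A 1%nat) = r * Y).
  { unfold A, Y. rewrite Cmod_mult, Cmod_pow, Cmod_R, Rabs_pos_eq by lra. ring. }
  assert (EA2 : Cmod (A (S (S m))) = r ^ S (S m) * X).
  { unfold A, X. rewrite Cmod_mult, Cmod_pow, Cmod_R, Rabs_pos_eq by lra. ring. }
  rewrite EA1, EA2 in H.
  pose proof (Rle_trans _ _ _ (Rle_abs _) H). lra. }
destruct (Rle_or_lt X (1 - Y ^ 2)) as [|Hlt]; [assumption|exfalso].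
assert (HS : 1 < X + Y ^ 2) by lra.
destruct (pow_near_one (S (S m)) (/ (X + Y ^ 2))) as [r [Hr Hp]].
{ rewrite <- Rinv_1. apply Rinv_lt_contravar; lra. }
specialize (Main r Hr).
apply (Rmult_lt_compat_r (X + Y ^ 2)) in Hp; [|lra].
rewrite Rinv_l in Hp by lra.
assert (r ^ S (S m) <= r ^ 2).
{ replace (r ^ S (S m)) with (r ^ 2 * r ^ m) by (simpl; ring).
  assert (r ^ m <= 1) by (rewrite <- (pow1 m); apply pow_incr; lra).
  pose proof (pow2_ge_0 r). nra. }
pose proof (pow2_ge_0 Y). rewrite Rpow_mult_distr in Main. nra.
Qed.

(** * Sums of nonnegative terms *)

Lemma nonneg_sum_from_le (m : nat) (u : nat -> R) (B : R) :
  (forall N, sum_n_m u m N <= B) -> Rbar_le (nonneg_sum_from m u) (Finite B).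
Proof.
intros H. unfold nonneg_sum_from. rewrite <- (Lim_seq_const B). apply Lim_seq_le_loc.
exists 0%nat. intros n _. apply H.
Qed.

Lemma partial_sum_le_nonneg_sum_from (m : nat) (u : nat -> R) (N : nat) :
  (forall n, 0 <= u n) -> Rbar_le (Finite (sum_n_m u m N)) (nonneg_sum_from m u).
Proof.
intros H. unfold nonneg_sum_from. rewrite <- (Lim_seq_const (sum_n_m u m N)). apply Lim_seq_le_loc.
exists N. intros n Hn. induction Hn as [|n Hn IH]; [lra|].
destruct (Nat.le_gt_cases m (S n)) as [Hm|Hm].
- rewrite sum_n_Sm by exact Hm. change plus with Rplus. specialize (H (S n)). lra.
- rewrite (sum_n_m_zero _ m n) in IH by lia. rewrite (sum_n_m_zero _ m (S n)) by lia. exact IH.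
Qed.

(** Also for infinite [L], where doubling is governed by the conventions of
    [Rbar_mult]. *)
Lemma Rbar_twice_le (L : Rbar) (p : R) :
  Rbar_le (Rbar_mult (Finite 2) L) (Finite p) <-> Rbar_le L (Finite (p / 2)).
Proof.
destruct L as [l| |]; unfold Rbar_mult; simpl.
- split; intros; lra.
- destruct (Rle_dec 0 2) as [H|H]; [|lra]. destruct (Rle_lt_or_eq_dec 0 2 H) as [H'|H']; [|lra].
simpl. tauto.
- destruct (Rle_dec 0 2) as [H|H]; [|lra]. destruct (Rle_lt_or_eq_dec 0 2 H) as [H'|H']; [|lra].
simpl. tauto.
Qed.

(** * The Bohr inequality for the derivative *)

(** With [Y = |a 1|], the sum is at most [Y phi_0 + (1 - Y^2) T] where [T] is the
    weighted tail and [T <= phi_0 / 2]; and [Y + (1 - Y^2) / 2 <= 1] is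
    [(1 - Y)^2 >= 0]. *)
Lemma bohr_sum_le (phi : nat -> R -> R) (r : R) (f : C -> C) :
  (forall n, 0 <= phi n r) ->
  Rbar_le (twice_weighted_tail phi r) (Finite (phi 0%nat r)) ->
  unit_ball_analytic f -> f (RtoC 0) = RtoC 0 ->
  Rbar_le (bohr_sum (C_derive f) phi r) (Finite (phi 0%nat r)).
Proof.
intros Hphi Htail Hf Hf0.
destruct (unit_ball_expansion f Hf) as [a [Hexp Hmean]].
pose proof (unit_ball_coefficient_bound f a Hf Hf0 Hmean) as Hbound.
set (Y := Cmod (a 1%nat)) in *.
assert (HY : 0 <= Y) by apply Cmod_ge_0.
assert (HY1 : Y <= 1).
{ pose proof (Hbound 0%nat). pose proof (Cmod_ge_0 (a 2%nat)). nra. }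
set (w := fun n => INR (n + 1) * phi n r) in *.
assert (Hw : forall n, 0 <= w n) by (intros n; apply Rmult_le_pos; [apply pos_INR|apply Hphi]).
assert (Hpart : forall N, sum_n_m w 1 N <= phi 0%nat r / 2).
{ intros N. apply Rbar_twice_le in Htail.
  exact (Rbar_le_trans _ _ _ (partial_sum_le_nonneg_sum_from 1 w N Hw) Htail). }
apply nonneg_sum_from_le. intros N.
apply Rle_trans with (Y * phi 0%nat r + (1 - Y ^ 2) * sum_n_m w 1 N).
- induction N as [|N IH].
  + rewrite sum_n_n, (sum_n_m_zero w) by lia. rewrite (taylor_coeffs_derive f a Hexp).
    rewrite Cmod_mult, Cmod_R. change zero with 0. simpl INR. rewrite Rabs_R1. fold Y. lra.
  + rewrite sum_n_Sm, (sum_n_Sm w) by lia. change plus with Rplus.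
    rewrite (taylor_coeffs_derive f a Hexp).
    rewrite Cmod_mult, Cmod_R, Rabs_pos_eq by apply pos_INR.
    replace (w (S N)) with (INR (S (S N)) * phi (S N) r) by (unfold w; f_equal; f_equal; lia).
    pose proof (Hbound N) as HN. pose proof (pos_INR (S (S N))). pose proof (Hphi (S N)).
    assert (INR (S (S N)) * phi (S N) r * Cmod (a (S (S N))) <= INR (S (S N)) * phi (S N) r * (1 - Y ^ 2)).
    { apply Rmult_le_compat_l; [apply Rmult_le_pos; assumption|exact HN]. }
    lra.
- specialize (Hpart N). pose proof (Hphi 0%nat).
  assert ((1 - Y ^ 2) * sum_n_m w 1 N <= (1 - Y ^ 2) * (phi 0%nat r / 2))
    by (apply Rmult_le_compat_l; [nra|exact Hpart]).
  assert (0 <= (1 - Y) ^ 2 * phi 0%nat r) by (apply Rmult_le_pos; [apply pow2_ge_0|assumption]).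
  nra.
Qed.

(** * Sharpness: a degree-two Blaschke product *)

(** The coordinate times the disk automorphism that exchanges [0] and [s]; it comes
    close to the identity as [s] tends to [1]. *)
Definition extremal (s : R) (z : C) : C := (z * (RtoC s - z) / (1 - RtoC s * z))%C.

(** Partial fractions: with [b = (1 - s^2) / s^2], the function is
    [z / s + b - b / (1 - s z)], and the last term is a geometric series about
    every centre [z0]. *)
Definition extremal_coeffs (s : R) (z0 : C) : nat -> C :=
  let b := ((1 - RtoC s ^ 2) / RtoC s ^ 2)%C in
  let d := (1 - RtoC s * z0)%C in
  PS_plus (K:=C_AbsRing) (V:=C_NormedModule)
    (PS_plus (K:=C_AbsRing) (V:=C_NormedModule) (fun n => (z0 / RtoC s + b) * 0 ^ n)%C
      (PS_incr_1 (K:=C_AbsRing) (V:=C_NormedModule) (fun n => / RtoC s * 0 ^ n)%C))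
    (fun n => (- b / d) * (RtoC s / d) ^ n)%C.

Lemma one_minus_scaled_neq0 (s : R) (z : C) : 0 < s < 1 -> unit_disk z -> (1 - RtoC s * z)%C <> 0.
Proof.
intros Hs Hz E. apply Ceq_minus in E. unfold unit_disk in Hz. pose proof (Cmod_ge_0 z).
assert (H1 : Cmod (RtoC s * z)%C = 1) by (rewrite <- E; apply Cmod_1).
rewrite Cmod_mult, Cmod_R, Rabs_pos_eq in H1 by lra. nra.
Qed.

Lemma extremal_pseries (s : R) (z0 z : C) : 0 < s ->
  Cmod (z - z0)%C < Cmod (1 - RtoC s * z0)%C / s ->
  is_pseries (extremal_coeffs s z0) (z - z0)%C (extremal s z).
Proof.
intros Hs Hz.
assert (Hsc : RtoC s <> 0) by (intros E; apply RtoC_inj in E; lra).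
set (d := (1 - RtoC s * z0)%C) in *.
assert (Hd : d <> 0).
{ intros E. rewrite E, Cmod_0 in Hz. pose proof (Cmod_ge_0 (z - z0)%C). unfold Rdiv in Hz. lra. }
assert (Hd' : 0 < Cmod d) by (apply Cmod_gt_0; exact Hd).
assert (Hq : Cmod (RtoC s / d * (z - z0))%C < 1).
{ rewrite Cmod_mult, Cmod_div, Cmod_R, Rabs_pos_eq by (assumption || lra).
  apply (Rmult_lt_compat_l (s / Cmod d)) in Hz; [|apply Rdiv_lt_0_compat; lra].
  replace (s / Cmod d * (Cmod d / s)) with 1 in Hz by (field; lra). exact Hz. }
assert (Hz1 : (1 - RtoC s * z)%C <> 0).
{ intros E. assert (E' : (RtoC s / d * (z - z0))%C = 1).
  { replace (RtoC s / d * (z - z0))%C with ((d - (1 - RtoC s * z)) / d)%C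
    by (unfold d; field; exact Hd).
    rewrite E. field. exact Hd. }
  rewrite E', Cmod_1 in Hq. lra. }
set (b := ((1 - RtoC s ^ 2) / RtoC s ^ 2)%C).
pose proof (geometric_pseries (- b / d) (RtoC s / d) (z - z0) Hq) as G.
pose proof (is_pseries_plus (K:=C_AbsRing) (V:=C_NormedModule) _ _ _ _ _
  (is_pseries_plus (K:=C_AbsRing) (V:=C_NormedModule) _ _ _ _ _
    (constant_pseries (z0 / RtoC s + b) (z - z0))
    (is_pseries_incr_1 (K:=C_AbsRing) (V:=C_NormedModule) _ _ _ (constant_pseries (/ RtoC s) (z - z0)))) G) as P.
replace (extremal s z) with (plus (G:=C_AbelianGroup) (plus (G:=C_AbelianGroup) (z0 / RtoC s + b)%C
   (scal (V:=C_NormedModule) (z - z0)%C (/ RtoC s)%C)) (- b / d / (1 - RtoC s / d * (z - z0)))%C).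
- exact P.
- change plus with Cplus. change scal with Cmult. ceq. unfold extremal, b.
  replace (1 - RtoC s / d * (z - z0))%C with ((1 - RtoC s * z) / d)%C
    by (unfold d in *; field; exact Hd).
  field. repeat split; assumption.
Qed.

Lemma extremal_unit_ball (s : R) : 0 < s < 1 -> unit_ball_analytic (extremal s).
Proof.
intros Hs. split.
- intros z0 Hz0. exists (extremal_coeffs s z0), (Cmod (1 - RtoC s * z0)%C / s).
  split.
  + apply Rdiv_lt_0_compat; [|lra]. apply Cmod_gt_0. apply one_minus_scaled_neq0; assumption.
  + intros z Hz. apply extremal_pseries; [lra|exact Hz].
- intros z Hz. pose proof (one_minus_scaled_neq0 s z Hs Hz) as Hn. unfold unit_disk in Hz.
  pose proof (Cmod_ge_0 z).
  unfold extremal. rewrite Cmod_div, Cmod_mult by exact Hn.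
  assert (Hpos : 0 < Cmod (1 - RtoC s * z)%C) by (apply Cmod_gt_0; exact Hn).
  assert (Hle : Cmod (RtoC s - z)%C <= Cmod (1 - RtoC s * z)%C).
  { apply Rsqr_incr_0_var; [|lra]. rewrite !Rsqr_pow2, !Cmod2_alt.
    assert (Hz2 : Re z ^ 2 + Im z ^ 2 < 1) by (rewrite <- Cmod2_alt; nra).
    destruct z as [x y]. simpl in *.
    assert (0 <= (1 - s * s) * (1 - (x * (x * 1) + y * (y * 1)))) by (apply Rmult_le_pos; nra).
    nra. }
  apply Rle_div_l; [exact Hpos|]. pose proof (Cmod_ge_0 (RtoC s - z)%C). nra.
Qed.

Lemma extremal_taylor (s : R) (z : C) : 0 < s < 1 -> unit_disk z ->
  is_pseries (extremal_coeffs s 0) z (extremal s z).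
Proof.
intros Hs Hz. unfold unit_disk in Hz.
assert (E : (z - 0)%C = z) by ring. rewrite <- E at 1. apply extremal_pseries; [lra|].
rewrite E. replace (1 - RtoC s * 0)%C with (RtoC 1) by ring. rewrite Cmod_1.
apply Rlt_le_trans with 1; [exact Hz|]. apply Rle_div_r; lra.
Qed.

Lemma extremal_coeff_1 (s : R) : 0 < s < 1 -> extremal_coeffs s 0 1%nat = RtoC s.
Proof.
intros Hs. assert (Hsc : RtoC s <> 0) by (intros E; apply RtoC_inj in E; lra).
unfold extremal_coeffs, PS_plus, PS_incr_1. change plus with Cplus. simpl. ceq.
replace (1 - RtoC s * 0)%C with (RtoC 1) by ring. field. exact Hsc.
Qed.

Lemma extremal_coeff_SS (s : R) n : 0 < s < 1 ->
  extremal_coeffs s 0 (S (S n)) = RtoC (- ((1 - s ^ 2) * s ^ n)).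
Proof.
intros Hs. assert (Hsc : RtoC s <> 0) by (intros E; apply RtoC_inj in E; lra).
unfold extremal_coeffs, PS_plus, PS_incr_1. change plus with Cplus.
rewrite RtoC_opp, RtoC_mult, RtoC_minus, !RtoC_pow.
replace (1 - RtoC s * 0)%C with (RtoC 1) by ring.
replace (RtoC s / 1)%C with (RtoC s) by field. simpl. ceq. field. exact Hsc.
Qed.

(** A finite part [W] of the tail already satisfies [phi_0 < 2 W]. Up to index [N] the
    sum for [extremal s] is at least [s phi_0 + (1 - s^2) s^N W], which exceeds
    [phi_0] as soon as [(1 + s) s^N W > phi_0]; this holds for [s] close to [1]. *)
Lemma bohr_sum_extremal_gt (phi : nat -> R -> R) (r : R) :
  (forall n, 0 <= phi n r) ->
  Rbar_lt (Finite (phi 0%nat r)) (twice_weighted_tail phi r) ->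
  exists s, 0 < s < 1 /\ Rbar_lt (Finite (phi 0%nat r)) (bohr_sum (C_derive (extremal s)) phi r).
Proof.
intros Hphi Htail.
set (w := fun n => INR (n + 1) * phi n r).
assert (Hw : forall n, 0 <= w n) by (intros n; apply Rmult_le_pos; [apply pos_INR|apply Hphi]).
assert (HN : exists N, phi 0%nat r < 2 * sum_n_m w 1 N).
{ apply Classical_Prop.NNPP. intros Hno.
  apply (Rbar_lt_not_le _ _ Htail). apply Rbar_twice_le, nonneg_sum_from_le. intros N.
  destruct (Rle_or_lt (sum_n_m w 1 N) (phi 0%nat r / 2)) as [|Hlt]; [assumption|].
  exfalso. apply Hno. exists N. lra. }
destruct HN as [N HN]. set (W := sum_n_m w 1 N) in *.
pose proof (Hphi 0%nat) as Hp0.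
(* One more power than [N], as [2 s] stands in for the factor [1 + s]. *)
destruct (pow_near_one (S N) (phi 0%nat r / (2 * W))) as [s [Hs Hpow]].
{ apply Rlt_div_l; lra. }
assert (HsW : phi 0%nat r < 2 * s * s ^ N * W).
{ apply (Rlt_div_l _ _ (2 * W)) in Hpow; [|lra]. rewrite <- tech_pow_Rmult in Hpow. lra. }
exists s. split; [exact Hs|].
set (u := fun n => Cmod (taylor_coeffs (C_derive (extremal s)) n) * phi n r).
assert (Hu : forall n, 0 <= u n) by (intros n; apply Rmult_le_pos; [apply Cmod_ge_0|apply Hphi]).
apply Rbar_lt_le_trans with (Finite (sum_n_m u 0 N)); [|apply partial_sum_le_nonneg_sum_from, Hu].
assert (Hcoef : forall n, taylor_coeffs (C_derive (extremal s)) n = (RtoC (INR (S n)) * extremal_coeffs s 0 (S n))%C).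
{ apply taylor_coeffs_derive. intros z Hz. apply extremal_taylor; assumption. }
assert (Hlow : forall k, (k <= N)%nat ->
  s * phi 0%nat r + (1 - s ^ 2) * s ^ N * sum_n_m w 1 k <= sum_n_m u 0 k).
{ induction k as [|k IH]; intros Hk.
  - rewrite sum_n_n, (sum_n_m_zero w) by lia. change zero with 0. unfold u.
    rewrite Hcoef, extremal_coeff_1 by exact Hs. rewrite Cmod_mult, !Cmod_R. simpl INR.
    rewrite Rabs_R1, (Rabs_pos_eq s) by lra. lra.
  - specialize (IH ltac:(lia)). rewrite (sum_n_Sm u), (sum_n_Sm w) by lia. change plus with Rplus.
    assert (u (S k) = (1 - s ^ 2) * s ^ k * w (S k)).
    { unfold u, w. rewrite Hcoef, extremal_coeff_SS by exact Hs.
      rewrite Cmod_mult, !Cmod_R, Rabs_Ropp, !Rabs_pos_eq.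
      - replace (S k + 1)%nat with (S (S k)) by lia. ring.
      - apply Rmult_le_pos; [nra|apply pow_le; lra].
      - apply pos_INR. }
    assert (s ^ N <= s ^ k).
    { replace N with (k + (N - k))%nat by lia. rewrite pow_add.
      assert (s ^ (N - k) <= 1) by (rewrite <- (pow1 (N - k)); apply pow_incr; lra).
      assert (0 <= s ^ k) by (apply pow_le; lra). nra. }
    assert ((1 - s ^ 2) * s ^ N * w (S k) <= (1 - s ^ 2) * s ^ k * w (S k)).
    { apply Rmult_le_compat_r; [apply Hw|]. apply Rmult_le_compat_l; [nra|assumption]. }
    lra. }
specialize (Hlow N (le_n N)). fold W in Hlow. simpl.
eapply Rlt_le_trans; [|exact Hlow].
assert (HP : 0 <= s ^ N) by (apply pow_le; lra).
assert (HsN : 0 <= s ^ N * W) by (apply Rmult_le_pos; [exact HP|lra]).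
assert (phi 0%nat r < (1 + s) * (s ^ N * W)) by nra.
replace ((1 - s ^ 2) * s ^ N * W) with ((1 - s) * ((1 + s) * (s ^ N * W))) by ring.
nra.
Qed.

Theorem theorem8 (phi : nat -> R -> R) (R0 : R)
  (hphi : admissible phi)
  (hR0 : 0 < R0 < 1)
  (hroot : Finite (phi 0%nat R0) = twice_weighted_tail phi R0)
  (hmin : forall x : R, 0 < x < 1 ->
     Finite (phi 0%nat x) = twice_weighted_tail phi x -> R0 <= x)
  (hineq : forall r : R, 0 <= r < R0 ->
     Rbar_le (twice_weighted_tail phi r) (Finite (phi 0%nat r))) :
  (forall f : C -> C, unit_ball_analytic f -> f (RtoC 0) = RtoC 0 ->
     forall r : R, 0 <= r <= R0 ->
       Rbar_le (bohr_sum (C_derive f) phi r) (Finite (phi 0%nat r)))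
  /\
  ((exists eps : R, 0 < eps /\ R0 + eps <= 1 /\
      forall x : R, R0 < x < R0 + eps ->
        Rbar_lt (Finite (phi 0%nat x)) (twice_weighted_tail phi x)) ->
   ~ exists R' : R, R0 < R' < 1 /\
      forall f : C -> C, unit_ball_analytic f -> f (RtoC 0) = RtoC 0 ->
        forall r : R, 0 <= r <= R' ->
          Rbar_le (bohr_sum (C_derive f) phi r) (Finite (phi 0%nat r))).
Proof.
destruct hphi as [Hnn _]. split.
- intros f Hf Hf0 r Hr. apply bohr_sum_le; try assumption.
  + intros n. apply Hnn. unfold unit_Ico; lra.
  + destruct (Rle_lt_or_eq_dec r R0 (proj2 Hr)) as [Hlt| ->].
    * apply hineq; lra.
    * rewrite <- hroot. apply Rbar_le_refl.
- intros [eps [He [He1 Hgt]]] [R' [HR' Hall]].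
  set (x := (R0 + Rmin (R0 + eps) R') / 2).
  assert (H1 : R0 < Rmin (R0 + eps) R') by (apply Rmin_glb_lt; lra).
  pose proof (Rmin_l (R0 + eps) R') as H2. pose proof (Rmin_r (R0 + eps) R') as H3.
  assert (Hx : R0 < x < Rmin (R0 + eps) R') by (unfold x; lra).
  destruct (bohr_sum_extremal_gt phi x) as [s [Hs Hlt]].
  + intros n. apply Hnn. unfold unit_Ico; lra.
  + apply Hgt. lra.
  + apply (Rbar_lt_not_le _ _ Hlt). apply Hall; [apply extremal_unit_ball, Hs| |lra].
    unfold extremal. replace (RtoC 0 * (RtoC s - RtoC 0))%C with (RtoC 0) by ring. apply Cmult_0_l.
Qed.
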